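(* For every positive integer $m$, $$\sigma(M_{11} \wr C_{m}) = \alpha(m) + 11^{m} + 12^{m}.$$
   Context: For a non-cyclic finite group $X$, $\sigma(X)$ denotes the least number of proper subgroups of $X$ whose union is $X$. $\alpha(m)$ is the number of distinct prime divisors of $m$ (so $\alpha(1)=0$). $M_{11}$ is the Mathieu group of degree $11$. $C_m$ is the cyclic group of order $m$, and $S \wr C_m$ is the wreath product $S^m \rtimes C_m$ in which a generator of $C_m$ permutes the $m$ coordinates cyclically. *)

(* Defs.v *)
From mathcomp Require Import all_boot all_fingroup all_solvable.

Set Implicit Arguments.
Unset Strict Implicit.
Unset Printing Implicit Defensive.

Local Open Scope group_scope.

Section CoveringNumber.

Variable gT : finGroupType.
Implicit Types (G : {group gT}) (P : {set {group gT}}).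

Definition proper_cover G P :=
  [forall H in P, H \proper G] && (\bigcup_(H in P) (H : {set gT}) == G).

(* The default of the arg min is the family of all proper subgroups of G, which
   covers G exactly when G is not cyclic (see sigmaP); for a cyclic group, which
   has no covering number, the value of sigma is meaningless. *)
Definition sigma G : nat :=
  #|[arg min_(P < [set H : {group gT} | H \proper G] | proper_cover G P) #|P| ]|.

Lemma proper_cover_all G :
  ~~ cyclic G -> proper_cover G [set H : {group gT} | H \proper G].
Proof.
move=> ncG; apply/andP; split; first by apply/forall_inP => H; rewrite inE.
rewrite eqEsubset; apply/andP; split.
  by apply/bigcupsP => H; rewrite inE => /proper_sub.
apply/subsetP => x Gx; apply/bigcupP; exists <[x]>%G; last exact: cycle_id.
rewrite inE properEneq cycle_subG Gx andbT.
by apply: contra ncG => /eqP <-; apply: cycle_cyclic.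
Qed.

Lemma sigmaP G : ~~ cyclic G ->
  (exists2 P, proper_cover G P & #|P| = sigma G) /\
  (forall P, proper_cover G P -> sigma G <= #|P|).
Proof.
move=> /proper_cover_all cG; rewrite /sigma.
by case: arg_minnP => // P cP minP; split=> //; exists P.
Qed.

End CoveringNumber.

Section PermutationalWreathProduct.

Variables (gT : finGroupType) (n : nat).

Local Notation base_group := {dffun forall _ : 'I_n, gT}.

(* The coordinate of index i is moved to index s i. *)
Definition wr_act (f : base_group) (s : 'S_n) : base_group :=
  [ffun i => f (s^-1 i)].

Lemma wr_act1 f : wr_act f 1 = f.
Proof. by apply/ffunP => i; rewrite ffunE invg1 perm1. Qed.

Lemma wr_actM f : act_morph wr_act f.
Proof. by move=> s t; apply/ffunP => i; rewrite !ffunE invMg permM. Qed.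

Definition wr_action := TotalAction wr_act1 wr_actM.

Lemma wr_is_groupAction : is_groupAction [set: base_group] wr_action.
Proof.
move=> s _; rewrite /= inE; apply/andP; split.
  by apply/subsetP => f; rewrite inE.
apply/morphicP => f g _ _; rewrite !actpermE /=.
by apply/ffunP => i; rewrite !ffunE.
Qed.

Definition wr_groupAction := GroupAction wr_is_groupAction.

(* The semidirect product gT ^ n ><| H for a permutation group H of degree n. *)
Definition wreath (H : {group 'S_n}) : finGroupType :=
  sdprod_by (wr_groupAction \ subsetT H).

End PermutationalWreathProduct.

(* The n-cycle i |-> i + 1 (mod n). *)
Definition shift_perm n : 'S_n := perm (@ordS_inj n).

Definition wreath_cyclic (gT : finGroupType) (m : nat) : finGroupType :=
  wreath gT <[shift_perm m]>.

Definition cycle4 (T : finType) (a b c d : T) : {perm T} :=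
  tperm a b * tperm a c * tperm a d.

(* The usual generators (1,2,3,4,5,6,7,8,9,10,11) and (3,7,11,8)(4,10,5,6) of
   M11, with the points renumbered from 0 to 10. *)
Definition M11_gen : 'S_11 :=
  cycle4 (inord 2) (inord 6) (inord 10) (inord 7)
  * cycle4 (inord 3) (inord 9) (inord 4) (inord 5).

Definition M11 : {group 'S_11} := <<[set shift_perm 11; M11_gen]>>%G.

Definition M11_wr_C (m : nat) : finGroupType := wreath_cyclic (subg_of M11) m.

(* Main.v *)
Require Import Defs.
From mathcomp Require Import all_boot all_fingroup all_solvable.
From mathcomp Require Import all_order all_algebra.
From mathcomp Require Import zify lra.

Set Implicit Arguments.
Unset Strict Implicit.
Unset Printing Implicit Defensive.
Import GroupScope.

(** Let S = M11 and G = S ^ m ><| <[c]>, with c the cycle of length m, and let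
    alpha(m) be the number of prime divisors of m.

    Few subgroups suffice. An element of G over a non generator of <[c]> lies
    over the subgroup generated by c ^+ r for some prime divisor r of m; this
    costs alpha(m) subgroups. An element u over a generator permutes the m
    coordinates in one cycle, and it fixes a point of Omega ^ m, for an S-set
    Omega, if and only if the product of its coordinates along the cycle fixes a
    point of Omega. Now M11 acts on 11 points and on the 12 cosets of PSL(2, 11),
    and each element has a fixed point in one of these actions (M11_cover). So
    the 11 ^ m + 12 ^ m stabilizers of the points of Omega ^ m cover the rest
    (covering_upper_bound).

    Fewer do not. By linear programming duality (fractional_cover) it is enough
    to put weights of total sum alpha(m) + 11 ^ m + 12 ^ m on the elements of G
    such that no proper subgroup K has weight more than 1 (weight_le1). The weight
    is carried by the elements over c whose cycle product has order 8, or order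
    11, and by the elements over c ^+ r, for r a prime divisor of m, whose
    products along two given cycles have orders 11 and 8. A subgroup K that
    contains an element over c is either of product type, with conjugate
    projections to proper subgroups of S on all coordinates, or of diagonal type,
    with an intersection with S ^ m of order at most |S| ^ (m / 2)
    (card_subdirect_le). The first kind is controlled by counting the elements of
    orders 8 and 11 in the subgroups of M11, no proper one of which has both; the
    second kind is too small to matter.

    The facts needed about M11 follow from its order 7920, from the triviality
    of the stabilizer of four given points, and from M11_cover. These are obtained
    by enumerating the 720 elements of a point stabilizer. The rest is the theorem
    of Sylow: a subgroup with elements of order 11 is M11 or has order 11, 55 or
    660 (M11_subgroup_order11), which also yields simplicity, and an element of
    order 8 generates the only cyclic subgroup of order 8 in a Sylow 2-subgroup
    (cycle8_unique), which bounds the number of elements of order 8 of the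
    subgroups of order prime to 11 (card_order8_le). *)

(** * Weights and covers *)

Section FractionalCover.
Import Order.TTheory GRing.Theory Num.Theory.
Local Open Scope ring_scope.

(** Weak duality for the covering problem: summing the weights of all members of
    a cover counts every element at least once, and each member contributes at
    most 1. *)
Lemma fractional_cover (rT : finGroupType) (G : {group rT}) P (w : rT -> rat) :
    proper_cover G P -> (forall x, 0 <= w x) ->
    (forall K : {group rT}, K \proper G -> \sum_(x in K) w x <= 1) ->
  \sum_(x in G) w x <= #|P|%:R.
Proof.
case/andP=> /forall_inP properP /eqP coverP w0 wK.
apply: (@le_trans _ _ (\sum_(H in P) \sum_(x in H) w x)); last first.
  rewrite -sumr_const; apply: ler_sum => H PH.
  exact/wK/properP.
rewrite (exchange_big_dep (mem G)) /=; last first.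
  by move=> H x PH Hx; rewrite -coverP; apply/bigcupP; exists H.
apply: ler_sum => x; rewrite -coverP => /bigcupP[H PH Hx].
by rewrite (bigD1 H) ?PH //= lerDl sumr_ge0.
Qed.
End FractionalCover.

(** * Subdirect subgroups of powers of a simple group *)

Section SubdirectPower.

Variables (gT : finGroupType) (I : finType).
Local Notation gTI := {dffun forall _ : I, gT}.
Implicit Types (L : {group gTI}) (B : {set I}) (f : gTI).

Definition trivial_on B : {set gTI} := [set f : gTI | [forall i in B, f i == 1]].

Lemma trivial_onP B f : reflect {in B, forall i, f i = 1} (f \in trivial_on B).
Proof. by rewrite inE; apply: (iffP forall_inP) => f1 i /f1 => [/eqP | ->]. Qed.

Lemma trivial_on_group_set B : group_set (trivial_on B).
Proof.
apply/group_setP; split=> [|f g /trivial_onP f1 /trivial_onP g1].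
  by apply/trivial_onP => i _; rewrite oneg_ffun.
by apply/trivial_onP => i Bi; rewrite mulg_ffun f1 ?g1 ?mulg1.
Qed.
Canonical trivial_on_group B := Group (trivial_on_group_set B).

Lemma conjg_ffun f g i : (f ^ g) i = f i ^ g i.
Proof. exact: (morphJ (dffun_morphism (fun=> gT) i) (in_setT f) (in_setT g)). Qed.

Lemma normal_trivial_on B L : L :&: trivial_on B <| L.
Proof.
rewrite /normal subsetIl; apply/normsP => g Lg; apply/setP => f.
rewrite mem_conjg !inE groupJr ?groupV //; congr (_ && _).
by apply: eq_forallb_in => i _; rewrite conjg_ffun conjg_eq1.
Qed.

Hypothesis simpleS : simple [set: gT].

(** The image of D in the factor i is normal in the simple factor, hence all
    of it as soon as it is not trivial. *)
Lemma normal_subdirect L (D : {group gTI}) i f x :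
    dffun_morphism (fun=> gT) i @* L = [set: gT] -> D <| L -> f \in D -> f i != 1 ->
  exists2 d, d \in D & d i = x.
Proof.
move=> surjL nDL Df fi.
have /simpleP[_ sS] := simpleS.
have := morphim_normal (dffun_morphism (fun=> gT) i) nDL; rewrite surjL => nD.
have [D1|DT] := sS _ nD.
  have := mem_morphim (dffun_morphism (fun=> gT) i) (in_setT f) Df.
  by rewrite D1 inE (negPf fi).
have /morphimP[d _ Dd ->] : x \in dffun_morphism (fun=> gT) i @* D by rewrite DT inE.
by exists d.
Qed.

Hypothesis nabS : ~~ abelian [set: gT].

(** A subdirect subgroup of a power of a simple group is a product of diagonals;
    if no element is supported on a single factor then every diagonal runs
    through at least two factors, which leaves at most half as many diagonals as
    factors. The diagonals need not be described for this count. Let B be a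
    minimal set of coordinates that determines the elements of L. By minimality
    each j in B has an element of L that is trivial on B outside j but not at j;
    such an element is non trivial at some i outside B. The set D j of these
    elements is normal in L and so covers the factor i, and if i served two
    indices j then two commuting subgroups D j would both cover that factor,
    which would make it abelian. So j |-> i embeds B into its complement. *)
Lemma card_subdirect_le L :
    (forall i, dffun_morphism (fun=> gT) i @* L = [set: gT]) ->
    (forall i, L :&: trivial_on [set~ i] = 1) ->
  exists2 k, 2 * k <= #|I| & #|L| <= #|gT| ^ k.
Proof.
move=> surjL noSingle.
pose faithful_on B := L :&: trivial_on B == 1.
have fT : faithful_on setT.
  apply/eqP/trivgP/subsetP => f /setIP[_ /trivial_onP f1].
  by rewrite inE; apply/eqP/ffunP => i; rewrite f1 ?oneg_ffun ?inE.
have [B /minsetP[/eqP fB minB] _] := @minset_exists _ faithful_on _ fT.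
pose D j := L :&: trivial_on (B :\ j).
pose linked j i := (i \notin B) && [exists f in D j, f i != 1].
have linkB j : j \in B -> exists i, linked j i.
  move=> Bj; have : ~~ faithful_on (B :\ j).
    apply/negP => /minB BE; have := setD11 j B.
    by rewrite BE ?Bj ?subD1set.
  rewrite /faithful_on -subG1 => /subsetPn[f Df]; rewrite inE => f1.
  have [Lf /trivial_onP fBj] := setIP Df.
  have fj : f j != 1.
    apply: contra f1 => /eqP fj; have : f \in L :&: trivial_on B.
      rewrite inE Lf; apply/trivial_onP => i Bi.
      by have [->|ji] := eqVneq i j; rewrite // fBj // in_setD1 ji.
    by rewrite fB inE.
  have : f \notin L :&: trivial_on [set~ j].
    by rewrite noSingle inE.
  rewrite inE Lf inE negb_forall_in => /exists_inP[i ji fi]; exists i.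
  apply/andP; split; last by apply/exists_inP; exists f.
  by apply: contra fi => Bi; rewrite fBj // in_setD1 Bi andbT; rewrite !inE in ji.
pose h j := odflt j [pick i | linked j i].
have hP j : j \in B -> linked j (h j).
  by move=> /linkB[i Li]; rewrite /h; case: pickP => [//|/(_ i)/negP].
have h_inj : {in B &, injective h}.
  move=> j k Bj Bk hjk; apply/eqP; apply: contraR nabS => jk.
  have [/andP[_ /exists_inP[f Df fi]] /andP[_ /exists_inP[g Dg gi]]] := (hP _ Bj, hP _ Bk).
  apply/centsP => x _ y _.
  have [d Dd <-] := normal_subdirect x (surjL _) (normal_trivial_on _ _) Df fi.
  have [e De <-] := normal_subdirect y (surjL _) (normal_trivial_on _ _) Dg gi.
  have [/setIP[Ld /trivial_onP dB] /setIP[Le /trivial_onP eB]] := (Dd, De).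
  have : [~ d, e] \in L :&: trivial_on B.
    rewrite inE groupR //=; apply/trivial_onP => i Bi.
    rewrite /commg mulg_ffun invg_ffun conjg_ffun.
    have [ij|ij] := eqVneq i j.
      by rewrite [e i]eB ?conjg1 ?mulVg // !inE ij jk -ij.
    by rewrite dB ?conj1g ?mulg1 ?invg1 // !inE ij.
  rewrite fB inE => /commgP/(congr1 (fun f : gTI => f (h k))).
  by rewrite !mulg_ffun -hjk.
exists #|B|.
  rewrite mul2n -addnn -(cardsC B) leq_add2l -(card_in_imset h_inj) subset_leq_card //.
  by apply/subsetP => _ /imsetP[j Bj ->]; rewrite inE; case/andP: (hP j Bj).
pose rho f : gTI := [ffun i => if i \in B then f i else 1].
have rho_inj : {in L &, injective rho}.
  move=> f g Lf Lg /ffunP fg; apply/eqP; rewrite eq_mulgV1.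
  suff : f * g^-1 \in L :&: trivial_on B by rewrite fB inE.
  rewrite inE groupM ?groupV //; apply/trivial_onP => i Bi.
  by have := fg i; rewrite !ffunE Bi => ->; rewrite mulgV.
rewrite -(card_in_imset rho_inj) -[#|gT|]cardsT.
pose F i : {set gT} := if i \in B then setT else 1.
apply: (@leq_trans #|setXn F|).
  apply/subset_leq_card/subsetP => _ /imsetP[f _ ->]; apply/setXnP => i.
  by rewrite ffunE /F; case: ifP; rewrite ?inE.
rewrite cardsXn (bigID (mem B)) /= [X in (_ * X)%N]big1 => [|i /negPf Bi]; last first.
  by rewrite /F Bi cards1.
by rewrite muln1 -prod_nat_const leq_prod // => i; rewrite /F => ->.
Qed.
End SubdirectPower.

(** * Elements of a wreath product with a cyclic group *)

Lemma shift_permX m k (i : 'I_m) : (shift_perm m ^+ k) i = (i + k) %% m :> nat.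
Proof.
elim: k i => [|k IHk] i; first by rewrite expg0 perm1 addn0 modn_small.
by rewrite expgSr permM permE /= IHk -addn1 modnDml addn1 addnS.
Qed.

Lemma order_shift_perm m : 0 < m -> #[shift_perm m] = m.
Proof.
case: m => // n _; apply/eqP; rewrite eqn_dvd; apply/andP; split.
  rewrite order_dvdn; apply/eqP/permP => i; apply: val_inj.
  by rewrite perm1 /= shift_permX modnDr modn_small.
have /(congr1 (fun s : 'S_n.+1 => val (s ord0))) := expg_order (shift_perm n.+1).
by rewrite perm1 /= shift_permX => /eqP.
Qed.

Lemma shift_perm_expm n : shift_perm n.+1 ^+ n.+1 = 1.
Proof. by apply/eqP; rewrite -order_dvdn order_shift_perm. Qed.

Section WreathElements.

Variables (gT : finGroupType) (n : nat).
Local Notation m := n.+1.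
Local Notation W := (wreath_cyclic gT m).
Local Notation c := (shift_perm m).
Local Notation base := {dffun forall _ : 'I_m, gT}.
Implicit Types (u v : W) (i j : 'I_m) (f : base).

Definition top u : 'S_m := u.1.
Definition coord u i : gT := u.2 i.

Lemma topM : {in setT &, {morph top : u v / u * v}}.
Proof. by []. Qed.
Canonical top_morphism := Morphism topM.

(** The pair (a, f) stands for the product a * f, so that the right factor
    first moves the coordinates of the left one. *)
Lemma coordM u v i : coord (u * v) i = coord u ((top v)^-1 i) * coord v i.
Proof. by rewrite /coord /= !ffunE. Qed.

Lemma topX u k : top (u ^+ k) = top u ^+ k.
Proof. by rewrite morphX ?inE. Qed.

Lemma topV u : top u^-1 = (top u)^-1.
Proof. by rewrite morphV ?inE. Qed.

Lemma top1 : top 1 = 1. Proof. by []. Qed.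

Lemma coord1 i : coord 1 i = 1.
Proof. by rewrite /coord /= ffunE. Qed.

Lemma coordV u i : coord u^-1 ((top u)^-1 i) = (coord u i)^-1.
Proof.
apply/eqP; rewrite eq_sym eq_invg_mul; apply/eqP.
have := coordM u u^-1 ((top u)^-1 i).
by rewrite mulgV coord1 topV invgK permKV.
Qed.

Lemma wreath_eqP u v : top u = top v -> coord u =1 coord v -> u = v.
Proof.
case: u v => [[a f] Ua] [[b g] Vb] ab fg; apply: val_inj; congr (_, _) => //.
exact/ffunP.
Qed.

Lemma top_cycle u : top u \in <[c]>.
Proof. by rewrite /top; case: u => [[a f] Ua] /=; case/setXP: Ua. Qed.

Lemma wr_subproof k f : (c ^+ k, f) \in setX <[c]> [set: base].
Proof. by rewrite in_setX mem_cycle inE. Qed.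
Definition wr k f : W := SdPair _ (wr_subproof k f).

Lemma top_wr k f : top (wr k f) = c ^+ k. Proof. by []. Qed.
Lemma coord_wr k f i : coord (wr k f) i = f i. Proof. by []. Qed.

Lemma card_base_group : #|[set: base]| = (#|gT| ^ m)%N.
Proof.
have -> : [set: base] = setXn (fun=> [set: gT]).
  by apply/setP => f; rewrite inE; symmetry; apply/setXnP => i; rewrite inE.
by rewrite cardsXn prod_nat_const card_ord cardsT.
Qed.

Lemma card_top k : #|[set u : W | top u == c ^+ k]| = (#|gT| ^ m)%N.
Proof.
have -> : [set u : W | top u == c ^+ k] = wr k @: [set: base].
  apply/setP => u; rewrite inE; apply/eqP/imsetP => [tu | [f _ ->]]; last by [].
  by exists (finfun (coord u)) => //; apply: wreath_eqP => // i; rewrite coord_wr ffunE.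
rewrite card_imset ?card_base_group // => f g /(congr1 (fun u => coord u)) fg.
by apply/ffunP => i; apply: (congr1 (@^~ i) fg).
Qed.

Lemma coordX_step u k i : coord (u ^+ k.+1) i = coord (u ^+ k) ((top u)^-1 i) * coord u i.
Proof. by rewrite expgSr coordM. Qed.

(** The coordinate j of [u ^+ k] is the product of the k coordinates of u met when
    the cycle of j under [top u] is walked backwards, and [coord u j] is its last
    factor. When the walks from points of J meet J only at their start, replacing
    the coordinates in J by those of [u ^+ k] is therefore an invertible change
    of variables: prescribing products along distinct cycles of [top u] is as
    restrictive as prescribing one coordinate on each of them. *)
Section CycleProducts.

Variables (a : 'S_m) (J : {set 'I_m}) (k : nat).
Hypothesis k_gt0 : 0 < k.
Hypothesis visitJ : forall j t, j \in J -> 0 < t < k -> (a ^- t) j \notin J.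

Definition cycle_coord u : base := [ffun i => if i \in J then coord (u ^+ k) i else coord u i].

(** All factors but the last are coordinates outside J. *)
Lemma eq_coordX u v j t : top u = a -> top v = a -> j \in J -> t < k -> 
 {in [predC J], coord u =1 coord v} -> coord (u ^+ t) (a^-1 j) = coord (v ^+ t) (a^-1 j).
Proof.
move=> ua va Jj + uv.
have gen i : (forall s, s < t -> (a ^- s) i \notin J) -> coord (u ^+ t) i = coord (v ^+ t) i.
  elim: t i => [|t IH] i Hi; first by rewrite !expg0 !coord1.
  have nJi : i \notin J by have := Hi 0 isT; rewrite expg0 invg1 perm1.
  rewrite !coordX_step ua va (uv i nJi) IH // => s st.
  by have := Hi s.+1 st; rewrite expgSr invMg permM.
move=> tk; apply: gen => s st; rewrite -permM -invMg -expgSr.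
by apply: visitJ; rewrite //= (leq_ltn_trans st).
Qed.

Lemma cycle_coord_inj : {in [set u : W | top u == a] &, injective cycle_coord}.
Proof.
move=> u v; rewrite !inE => /eqP ua /eqP va /ffunP uv.
have offJ : {in [predC J], coord u =1 coord v}.
  by move=> i /negPf Ji; have := uv i; rewrite !ffunE Ji.
apply: wreath_eqP => [|i]; first by rewrite ua.
have [Ji|nJi] := boolP (i \in J); last exact: offJ.
have := uv i; rewrite !ffunE Ji; case: k k_gt0 eq_coordX => // k' _ eqX.
by rewrite !coordX_step ua va (eqX u v) //; apply: mulgI.
Qed.

Lemma cycle_coord_le (U : {set W}) (F : 'I_m -> {set gT}) :
    {in U, forall u, top u = a} -> {in U, forall u i, cycle_coord u i \in F i} ->
  #|U| <= (\prod_i #|F i|)%N.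
Proof.
move=> Ua UF; rewrite -cardsXn -(@card_in_imset _ _ cycle_coord); last first.
  by move=> u v Uu Uv; apply: cycle_coord_inj; rewrite inE Ua.
apply/subset_leq_card/subsetP => _ /imsetP[u Uu ->].
by apply/setXnP => i; exact: (UF u Uu i).
Qed.

Lemma cycle_coord_card (F : 'I_m -> {set gT}) : a \in <[c]> ->
  #|[set u : W | top u == a & [forall i, cycle_coord u i \in F i]]| = (\prod_i #|F i|)%N.
Proof.
case/cycleP=> l al; rewrite -cardsXn.
have im : cycle_coord @: [set u | top u == a] = setT.
  apply/eqP; rewrite eqEcard subsetT (card_in_imset cycle_coord_inj) al card_top.
  by rewrite card_base_group leqnn.
rewrite -(@card_in_imset _ _ cycle_coord) => [|u v]; last first.
  rewrite !inE => /andP[ua _] /andP[va _].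
  by apply: cycle_coord_inj; rewrite inE.
apply: eq_card => f; apply/imsetP/setXnP => [[u + ->] | fF].
  by rewrite inE => /andP[_ /forallP].
have : f \in cycle_coord @: [set u | top u == a] by rewrite im inE.
case/imsetP=> u; rewrite inE => ua fE; exists u => //.
by rewrite inE ua -fE; apply/forallP.
Qed.

End CycleProducts.

End WreathElements.

(** * Subgroups of the wreath product *)

Section WreathSubgroups.
Variables (gT : finGroupType) (n : nat).
Local Notation m := n.+1.
Local Notation W := (wreath_cyclic gT m).
Local Notation c := (shift_perm m).
Local Notation base := {dffun forall _ : 'I_m, gT}.
Implicit Types (u v : W) (i j : 'I_m) (f : base) (K : {group W}).

Definition base_emb f : W := wr 0 f.

Lemma base_embM : {in setT &, {morph base_emb : f h / f * h}}.
Proof.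
move=> f h _ _; apply: wreath_eqP => [|i]; first by rewrite topM ?inE // !top_wr mulg1.
by rewrite coordM !coord_wr mulg_ffun top_wr invg1 perm1.
Qed.
Canonical base_emb_morphism := Morphism base_embM.

Lemma top_base_emb f : top (base_emb f) = 1. Proof. by []. Qed.
Lemma coord_base_emb f i : coord (base_emb f) i = f i. Proof. by []. Qed.

Lemma base_embE u f : top u = 1 -> (forall i, coord u i = f i) -> u = base_emb f.
Proof. by move=> u1 uf; apply: wreath_eqP. Qed.

Definition base_part K := base_emb @*^-1 K.
Canonical base_part_group K := [group of base_part K].

Lemma base_partE K f : (f \in base_part K) = (base_emb f \in K).
Proof. by rewrite !inE. Qed.

Definition proj K i := dffun_morphism (fun=> gT) i @* base_part K.
Canonical proj_group K i := [group of proj K i].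

Lemma coord_proj K u i : u \in K -> top u = 1 -> coord u i \in proj K i.
Proof.
move=> Ku u1; have E := base_embE u1 (fun i => esym (ffunE (coord u) i)).
have -> : coord u i = (dffun_morphism (fun=> gT) i) (finfun (coord u)) by rewrite /= ffunE.
by rewrite mem_morphim ?in_setT // base_partE -E.
Qed.

Section Generator.

Variables (K : {group W}) (g : W).
Hypotheses (Kg : g \in K) (gc : top g = c).

Lemma base_embJ f : base_emb f ^ g = base_emb [ffun i => f (c^-1 i) ^ coord g i].
Proof.
apply: base_embE => [|i].
  by rewrite (morphJ (top_morphism _ _)) ?in_setT // -[RHS](conj1g (top g)).
rewrite conjgE mulgA coordM coordM coord_base_emb ffunE top_base_emb invg1 perm1.
by rewrite -gc coordV conjgE mulgA.
Qed.

Lemma base_partJ f : f \in base_part K -> [ffun i => f (c^-1 i) ^ coord g i] \in base_part K.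
Proof. by rewrite !base_partE -base_embJ => Kf; rewrite groupJ. Qed.

(** Conjugation by g moves coordinate i to c i, which gives an inclusion; going
    once around the cycle turns it into an equality. *)
Lemma proj_step i : proj K (c i) = proj K i :^ coord g (c i).
Proof.
have inj : forall i, proj K i :^ coord g (c i) \subset proj K (c i).
  move=> j; apply/subsetP => _ /imsetP[_ /morphimP[f _ Lf ->] ->].
  have := mem_morphim (dffun_morphism (fun=> gT) (c j)) (in_setT _) (base_partJ Lf).
  by rewrite /= ffunE permK.
have mono j : #|proj K j| <= #|proj K (c j)|.
  by rewrite -(cardJg _ (coord g (c j))) subset_leq_card.
apply/eqP; rewrite eq_sym eqEcard inj cardJg.
have monoX k j : #|proj K j| <= #|proj K ((c ^+ k) j)|.
  elim: k => [|k IH]; first by rewrite expg0 perm1.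
  by apply: leq_trans IH _; rewrite expgSr permM mono.
have -> : proj K i = proj K ((c ^+ n) (c i)).
  by rewrite -permM -expgS shift_perm_expm perm1.
exact: monoX.
Qed.

Lemma proj_conj i : exists x, proj K i = proj K ord0 :^ x.
Proof.
have gen k : exists x, proj K ((c ^+ k) ord0) = proj K ord0 :^ x.
  elim: k => [|k [x IH]]; first by exists 1; rewrite expg0 perm1 conjsg1.
  by exists (x * coord g (c ((c ^+ k) ord0))); rewrite expgSr permM proj_step IH conjsgM.
have [x px] := gen i; exists x; rewrite -px; congr (proj K _).
by apply: val_inj; rewrite /= shift_permX /= add0n modn_small.
Qed.

(** An element of K over c differs from g by an element of the base part. *)
Lemma coord_proj_coset u i : u \in K -> top u = c -> coord u i \in coord g i *: proj K i.
Proof.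
move=> Ku uc; rewrite mem_lcoset.
have : coord (g^-1 * u) i \in proj K i.
  by apply: coord_proj; rewrite ?groupM ?groupV // topM ?in_setT // topV gc uc mulVg.
by rewrite coordM uc -gc coordV.
Qed.

Hypothesis simpleS : simple [set: gT].

(** If K contained a non trivial element supported on one coordinate then, the
    projections being onto a simple group, it would contain the whole factor at
    that coordinate, then by conjugation with g every factor, hence the base
    group; with g this generates the wreath product. *)
Lemma base_part_single : proj K ord0 = [set: gT] -> K \proper [set: W] ->
  forall i, base_part K :&: trivial_on gT [set~ i] = 1.
Proof.
move=> proj0 ltKW.
have projT i : proj K i = [set: gT].
  by have [x ->] := proj_conj i; rewrite proj0; apply/normP; rewrite inE subsetT.
pose T i := base_part K :&: trivial_on gT [set~ i].
have stepT i : T i != 1 -> T (c i) != 1.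
  rewrite -!subG1 => /subsetPn[f /setIP[Kf /trivial_onP f1] nf1].
  apply/subsetPn; exists [ffun j => f (c^-1 j) ^ coord g j].
    rewrite inE base_partJ //; apply/trivial_onP => j; rewrite !inE => ij.
    by rewrite ffunE f1 ?conj1g // !inE -(inj_eq (@perm_inj _ c)) permKV.
  apply: contra nf1; rewrite !inE => /eqP/ffunP fJ1; apply/eqP/ffunP => j.
  by have /eqP := fJ1 (c j); rewrite !ffunE permK conjg_eq1 => /eqP.
move=> i; apply/eqP; apply: contraTT ltKW => ntTi.
have ntT j : T j != 1.
  have gen k : T ((c ^+ k) i) != 1.
    by elim: k => [|k IH]; rewrite ?expg0 ?perm1 // expgSr permM stepT.
  have := gen (m - i + j)%N; congr (T _ != _).
  apply: val_inj; rewrite /= shift_permX addnA subnKC ?(ltnW (ltn_ord i)) //.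
  by rewrite modnDl modn_small.
rewrite properE subsetT negbK; apply/subsetP => u _.
have baseK f : base_emb f \in K.
  suff /subsetP sT : setXn (fun _ : 'I_m => [set: gT]) \subset base_part K.
    by rewrite -base_partE; apply: sT; apply/setXnP => j; rewrite inE.
  rewrite -(setXn_prod (fun=> [set: gT]%G)) prod_subG // => j _.
  apply/subsetP => h /set1gXnP[x _ ->].
  have := ntT j; rewrite -subG1 => /subsetPn[t Tt]; rewrite inE => nt1.
  have tj : t j != 1.
    apply: contra nt1 => /eqP tj; apply/eqP/ffunP => l; rewrite oneg_ffun.
    have [->//|lj] := eqVneq l j; have /setIP[_ /trivial_onP] := Tt; apply.
    by rewrite !inE.
  have [d /setIP[Kd /trivial_onP d1] <-] :=
    normal_subdirect simpleS x (projT j) (normal_trivial_on _ _) Tt tj.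
  have -> //: dfung1 (d j) = d.
  apply/ffunP => l; have [<-|lj] := eqVneq j l; first by rewrite dfung1_id.
  by rewrite dfung1_dflt // d1 // !inE eq_sym.
have /cycleP[k uk] := top_cycle u.
rewrite -(mulKVg (g ^+ k) u) groupMl ?groupX //.
rewrite (base_embE (u := _ * u) (f := finfun (coord (g ^- k * u)))) // => [|j].
  by rewrite topM ?in_setT // topV topX [top u]uk gc mulVg.
by rewrite ffunE.
Qed.

Lemma card_top_fiber (a : 'S_m) : #|[set u in K | top u == a]| <= #|base_part K|.
Proof.
have [-> | [u0]] := set_0Vmem [set u in K | top u == a]; first by rewrite cards0.
rewrite inE => /andP[Ku0 /eqP u0a].
rewrite -(card_imset _ (mulgI u0^-1)).
have emb_inj : injective base_emb.
  move=> f h fh; apply/ffunP => i; by rewrite -!coord_base_emb fh.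
rewrite -(card_imset _ emb_inj); apply/subset_leq_card/subsetP => v.
case/imsetP=> u; rewrite inE => /andP[Ku /eqP ua] ->.
have E : u0^-1 * u = base_emb (finfun (coord (u0^-1 * u))).
  apply: base_embE => [|i]; last by rewrite ffunE.
  by rewrite topM ?in_setT // topV u0a ua mulVg.
rewrite E imset_f // base_partE -E groupM ?groupV //.
Qed.

End Generator.
End WreathSubgroups.

(** * Covering by point stabilizers *)

Section CoveringSubgroups.

Variables (gT : finGroupType) (n : nat).
Local Notation m := n.+1.
Local Notation W := (wreath_cyclic gT m).
Local Notation c := (shift_perm m).
Implicit Types (u v : W) (i j : 'I_m).

(** With phi a tuple of points of a set on which gT acts by right
    multiplication, this is the stabilizer of phi in the product action of the
    wreath product. *)
Section Stabilizer.
Variable phi : {ffun 'I_m -> {set gT}}.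

Definition stab_fun : {set W} := [set u | [forall i, phi (top u i) == phi i :* coord u (top u i)]].

Lemma stab_funP u : reflect (forall i, phi (top u i) = phi i :* coord u (top u i)) (u \in stab_fun).
Proof. by rewrite inE; apply: (iffP forallP) => fix_u i; apply/eqP/fix_u. Qed.

Lemma stab_fun_group_set : group_set stab_fun.
Proof.
apply/group_setP; split=> [|u v /stab_funP fix_u /stab_funP fix_v]; apply/stab_funP => i.
  by rewrite top1 perm1 coord1 rcoset1.
by rewrite coordM topM ?in_setT // permM fix_v fix_u permK rcosetM.
Qed.
Canonical stab_fun_group := Group stab_fun_group_set.

End Stabilizer.

Lemma stab_fun_proper (A : {group gT}) phi : A \proper [set: gT] ->
  phi \in ffun_on (rcosets A [set: gT]) -> stab_fun phi \proper [set: W].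
Proof.
move=> ltA /ffun_onP/(_ ord0)/rcosetsP[y _ phi0].
rewrite properEneq subsetT andbT; apply: contraTneq ltA => stabT.
rewrite properE subsetT negbK; apply/subsetP => x _.
have : wr 0 [ffun=> x ^ y] \in stab_fun phi by rewrite stabT inE.
move/stab_funP/(_ ord0); rewrite top_wr expg0 perm1 coord_wr ffunE phi0.
rewrite -rcosetM conjgE !mulgA mulgV mul1g => E.
have : x * y \in A :* y by rewrite E rcoset_refl.
by rewrite mem_rcoset mulgK.
Qed.

Lemma coordX1 u k i : top u = 1 -> coord (u ^+ k) i = coord u i ^+ k.
Proof.
move=> u1; elim: k => [|k IH]; first by rewrite !expg0 coord1.
by rewrite !expgSr coordM u1 invg1 perm1 IH.
Qed.

Lemma rcoset_conj_fixed (A : {group gT}) x y : y \in A :^ x -> A :* x :* y = A :* x.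
Proof.
case/imsetP=> a Aa ->; rewrite -rcosetM conjgE !mulgA mulgV mul1g rcosetM.
by rewrite (rcoset_id Aa).
Qed.

(** When [top u] is a single cycle, a fixed point phi of u is determined by its
    value at 0, which the product of the coordinates along the cycle has to fix;
    conversely a point fixed by this product spreads to a fixed tuple, whose value
    after k steps is read off [u ^+ k]. *)
Lemma exists_stab_fun u (A : {group gT}) x : <[top u]> = <[c]> -> coord (u ^+ m) ord0 \in A :^ x ->
  exists2 phi, phi \in ffun_on (rcosets A [set: gT]) & u \in stab_fun phi.
Proof.
set a := top u => genu uA.
have ord_a : #[a] = m by rewrite orderE genu -orderE order_shift_perm.
have reach i : exists k, (a ^+ k) ord0 == i.
  have /cycleP[l cl] : c \in <[a]> by rewrite genu cycle_id.
  exists (l * i)%N; apply/eqP/val_inj.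
  by rewrite expgM -cl /= shift_permX /= add0n modn_small.
have [kap kapE] := fin_all_exists reach.
pose C k := A :* x :* coord (u ^+ k) ((a ^+ k) ord0).
have C_period d k : (a ^+ d) ord0 = ord0 -> C (d + k)%N = C k.
  move=> ad0; have /cycleP[t at_] : a ^+ d \in <[c]> by rewrite -genu mem_cycle.
  have /dvdnP[e de] : m %| d.
    rewrite -ord_a order_dvdn at_ -order_dvdn order_shift_perm //.
    by move: ad0; rewrite at_ => /(congr1 val); rewrite /= shift_permX /= add0n => /eqP.
  rewrite /C !expgD permM ad0 coordM topX permK rcosetM; congr (_ :* _).
  rewrite de mulnC expgM coordX1; last first.
    by rewrite topX; apply/eqP; rewrite -order_dvdn ord_a.
  by rewrite rcoset_conj_fixed ?groupX.
have C_eq k l : (a ^+ k) ord0 = (a ^+ l) ord0 -> C k = C l.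
  wlog le_kl : k l / k <= l => [wl akl | akl].
    by case/orP: (leq_total k l) => le; [exact: wl | apply/esym/wl].
  rewrite -(subnK le_kl) C_period //; apply: (@perm_inj _ (a ^+ k)).
  by rewrite -permM -expgD subnK.
exists [ffun i => C (kap i)].
  by apply/ffun_onP => i; rewrite ffunE /C -rcosetM mem_rcosets mulSGid ?subsetT ?inE.
apply/stab_funP => i; rewrite !ffunE -/a.
have -> : C (kap (a i)) = C (kap i).+1.
  by apply: C_eq; rewrite (eqP (kapE _)) expgSr permM (eqP (kapE i)).
by rewrite /C coordX_step (expgSr a) permM (eqP (kapE i)) permK rcosetM.
Qed.

(** These cover the elements over the non generators of [<[c]>]. *)
Definition level r := top_morphism gT n @*^-1 <[c ^+ r]>.
Canonical level_group r := [group of level r].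

Lemma level_proper r : r \in primes m -> level r \proper [set: W].
Proof.
rewrite mem_primes => /and3P[rP _ rm].
rewrite properEneq subsetT andbT; apply/eqP => levT.
have : wr 1 (1 : {dffun forall _ : 'I_m, gT}) \in level r by rewrite levT inE.
rewrite !inE /= top_wr expg1 -cycle_subG => /subset_leq_card.
rewrite -!orderE orderXdiv ?order_shift_perm // leqNgt ltn_Pdiv //.
exact: prime_gt1.
Qed.

Lemma level_or_generator u : <[top u]> = <[c]> \/ exists2 r, r \in primes m & u \in level r.
Proof.
have /cycleP[k uk] := top_cycle u; rewrite uk.
have [g1|g1] := eqVneq (gcdn m k) 1%N.
  left; apply/eqP; rewrite eqEcard cycle_subG mem_cycle -!orderE /=.
  by rewrite orderXgcd order_shift_perm // g1 divn1.
right; have g_gt1 : (1 < gcdn m k)%N by move: g1 (gcdn_gt0 m k); case: (gcdn m k) => [|[]].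
have := dvdn_trans (pdiv_dvd _) (dvdn_gcdr m k).
have := pdiv_prime g_gt1; have := dvdn_trans (pdiv_dvd _) (dvdn_gcdl m k).
move: (pdiv _) => p pm p_prime /dvdnP[l kl]; exists p.
  by rewrite mem_primes p_prime.
by rewrite !inE /= uk kl mulnC expgM mem_cycle.
Qed.

Variable A : bool -> {group gT}.
Hypothesis properA : forall b, A b \proper [set: gT].
Hypothesis coverA : forall x, exists b y, x \in A b :^ y.

(** For u over a generator of [<[c]>], the coordinate 0 of [u ^+ m] is the
    product along the only cycle; it lies in a conjugate of some A b, so it fixes
    a coset of A b. *)
Lemma covering_upper_bound : exists2 P, proper_cover [set: W]%G P &
  (#|P| <= size (primes m) + #|[set: gT] : A true| ^ m + #|[set: gT] : A false| ^ m)%N.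
Proof.
pose PA b := stab_fun_group @: ffun_on (rcosets (A b) [set: gT]).
pose PR := [set:: map level_group (primes m)].
exists (PR :|: PA true :|: PA false).
  have PP H : (H \in PR :|: PA true :|: PA false) = (H \in PR) || [exists b, H \in PA b].
    rewrite !inE -orbA; congr (_ || _).
    apply/orP/existsP => [[H1|H1]|[[]]]; by [exists true | exists false | left | right].
  apply/andP; split.
    apply/forall_inP => H; rewrite PP => /orP[|/existsP[b /imsetP[phi phiA ->]]].
      by rewrite inE => /mapP[r rm ->]; apply: level_proper.
    exact: stab_fun_proper (properA b) phiA.
  rewrite -subTset; apply/subsetP => u _; apply/bigcupP.
  have [gen|[r rm ur]] := level_or_generator u; last first.
    by exists (level_group r) => //; rewrite PP inE map_f.
  have [b [x uA]] := coverA (coord (u ^+ m) ord0).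
  have [phi phiA uphi] := exists_stab_fun gen uA.
  exists (stab_fun_group phi) => //; rewrite PP; apply/orP; right.
  by apply/existsP; exists b; apply: imset_f.
have cPA b : (#|PA b| <= #|[set: gT] : A b| ^ m)%N.
  apply: leq_trans (leq_imset_card _ _) _.
  by rewrite card_ffun_on card_ord.
have cPR : #|PR| <= size (primes m).
  by rewrite cardsE -(size_map level_group) card_size.
apply: leq_trans (leq_card_setU _ _) _; rewrite leq_add ?cPA //.
by apply: leq_trans (leq_card_setU _ _) _; rewrite leq_add ?cPA.
Qed.

End CoveringSubgroups.

(** * The lower bound *)

Lemma leq_expn_base a b k : (a <= b)%N -> (a ^ k <= b ^ k)%N.
Proof. by case: k => // k ab; rewrite leq_exp2r. Qed.

Section LowerBound.

Variables (gT : finGroupType) (n : nat) (A : bool -> {group gT}) (X : bool -> {set gT}).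
Local Notation m := n.+1.
Local Notation W := (wreath_cyclic gT m).
Local Notation c := (shift_perm m).
Local Notation q := #|gT|.
Implicit Types (u v : W) (i j : 'I_m) (K : {group W}).

(* The elements of X b are those that are hard to cover by anything but conjugates
   of A b: capX says that no proper subgroup contains more of them than A b, and
   that none meets both classes. The bounds bigA and bigX are what makes the
   subgroups of diagonal type negligible. *)
Hypothesis simpleS : simple [set: gT].
Hypothesis nabS : ~~ abelian [set: gT].
Hypothesis normX : forall b x, X b :^ x = X b.
Hypothesis capX : forall M : {group gT}, M \proper [set: gT] ->
  exists b, [/\ M :&: X (~~ b) = set0, #|M| <= #|A b| & #|M :&: X b| <= #|A b :&: X b|].
Hypothesis cardX : forall b, #|X b| = (#|[set: gT] : A b| * #|A b :&: X b|)%N.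
Hypothesis bigA : forall b, (4 * q <= #|A b| * #|A b :&: X b|)%N.
Hypothesis bigX : (2 * q <= #|X true| * #|X false|)%N.

(** For u over c, the coordinate 0 of [u ^+ m] is the product along the only
    cycle. *)
Definition single b := [set u : W | top u == c & coord (u ^+ m) ord0 \in X b].

(* The default value 0 of i1 is taken only for m = 1, which has no prime divisor. *)
Let i1 : 'I_m := inord 1.

(** The permutation [c ^+ r] has the r cycles given by the residues modulo r; the
    products along the cycles of 0 and 1 are taken in different classes, so that
    no subgroup of product type that projects onto [<[c]>] contains such an
    element. *)
Definition mixed r := [set u : W | top u == c ^+ r &
  (coord (u ^+ (m %/ r)) ord0 \in X true) && (coord (u ^+ (m %/ r)) i1 \in X false)].

Lemma shift_permV0 t i : (c ^- t) i = ord0 -> i = t %% m :> nat.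
Proof.
move=> E; have : i = (c ^+ t) ord0 by rewrite -E permKV.
by move/(congr1 val); rewrite /= shift_permX.
Qed.

Lemma single_visit j t : j \in [set ord0] -> (0 < t < m)%N -> (c ^- t) j \notin [set ord0].
Proof.
rewrite !inE => /eqP-> /andP[t0 tm]; apply/eqP => /shift_permV0 /=.
by rewrite modn_small // => t00; rewrite -t00 in t0.
Qed.

Lemma card_single b : #|single b| = (#|X b| * q ^ n)%N.
Proof.
pose F i := if i == ord0 then X b else [set: gT].
have := cycle_coord_card (ltn0Sn n) (@single_visit) F (cycle_id c).
have -> : [set u : W | top u == c &
             [forall i, cycle_coord [set ord0] m u i \in F i]] = single b.
  apply/setP => u; rewrite !inE; congr (_ && _); apply/forallP/idP => [/(_ ord0)|uX i].
    by rewrite ffunE /F inE eqxx.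
  by rewrite ffunE /F inE; case: eqP => [->|]; rewrite ?inE.
move=> ->; rewrite (bigD1 ord0) //=; congr (_ * _)%N.
rewrite (eq_bigr (fun=> q)) => [|i /negPf i0]; last by rewrite /F i0 cardsT.
by rewrite prod_nat_const cardC1 card_ord.
Qed.

Lemma coordX_proj K u k i : u \in K -> top u ^+ k = 1 -> coord (u ^+ k) i \in proj K i.
Proof. by move=> Ku uk; rewrite coord_proj ?groupX // topX. Qed.

(** An element of K over c has its coordinates in cosets of the projections of
    K, and its cycle product in the projection itself because the m-th power of
    the element is in the base part. *)
Lemma card_single_product K u0 b : u0 \in K -> top u0 = c ->
    #|proj K ord0| <= #|A b| -> #|proj K ord0 :&: X b| <= #|A b :&: X b| ->
  (#|K :&: single b| <= #|A b :&: X b| * #|A b| ^ n)%N.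
Proof.
move=> Ku0 u0c leM leX.
pose F i := if i == ord0 then proj K ord0 :&: X b else coord u0 i *: proj K i.
have cK i : #|proj K i| = #|proj K ord0|.
  by have [x ->] := proj_conj Ku0 u0c i; rewrite cardJg.
have := @cycle_coord_le _ n c [set ord0] m (ltn0Sn n) (@single_visit) (K :&: single b) F.
rewrite (bigD1 ord0) //= (eq_bigr (fun=> #|proj K ord0|)) => [|i /negPf i0]; last first.
  by rewrite /F i0 card_lcoset cK.
rewrite prod_nat_const cardC1 card_ord /F eqxx => le.
apply: leq_trans (le _ _) _.
- by move=> u /setIP[_]; rewrite inE => /andP[/eqP].
- move=> u /setIP[Ku]; rewrite inE => /andP[/eqP uc uX] i; rewrite ffunE inE.
  case: eqP => [->|_]; first by rewrite inE uX coordX_proj // uc shift_perm_expm.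
  exact: coord_proj_coset.
by rewrite leq_mul // leq_expn_base.
Qed.

Section PrimeLevel.
Variable r : nat.
Hypothesis r_m : r \in primes m.

Let r_prime : prime r. Proof. by move: r_m; rewrite mem_primes => /andP[]. Qed.
Let r_dvd : r %| m. Proof. by move: r_m; rewrite mem_primes => /and3P[]. Qed.
Let r_gt1 : (1 < r)%N. Proof. exact: prime_gt1. Qed.
Let m_gt1 : (1 < m)%N. Proof. exact: leq_trans r_gt1 (dvdn_leq _ r_dvd). Qed.

Lemma val_i1 : i1 = 1%N :> nat. Proof. by rewrite inordK. Qed.

Lemma i1_neq0 : i1 != ord0. Proof. by rewrite -val_eqE /= val_i1. Qed.

Lemma mixed_visit j t : j \in [set ord0; i1] -> (0 < t < m %/ r)%N ->
  ((c ^+ r) ^- t) j \notin [set ord0; i1].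
Proof.
move=> Jj /andP[t0 tm]; have rt_m : (r * t < m)%N.
  by rewrite -(divnK r_dvd) mulnC ltn_pmul2r // ltnW.
set i := _ j; apply/negP => Ji.
have : j = ((i + r * t) %% m)%N :> nat by rewrite -shift_permX expgM permKV.
have rt_gt0 : (0 < r * t)%N by rewrite muln_gt0 ltnW.
move: Jj Ji; rewrite !inE => /orP[]/eqP-> /orP[]/eqP->; rewrite ?val_i1 /=.
- by rewrite add0n modn_small // => E; rewrite -E in rt_gt0.
- move/esym/eqP; rewrite -/(dvdn m _) => /(dvdn_trans r_dvd).
  by rewrite dvdn_addl ?dvdn_mulr // dvdn1; case: (r) r_gt1 => [|[]].
- rewrite add0n modn_small // => E.
  by have := dvdn_mulr t (dvdnn r); rewrite -E dvdn1; case: (r) r_gt1 => [|[]].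
move=> E; have /eqP : (1 + r * t = 1 + 0 %[mod m])%N by rewrite -E addn0 modn_small.
by rewrite eqn_modDl mod0n modn_small // => /eqP E0; rewrite E0 in rt_gt0.
Qed.

Lemma card_mixed : #|mixed r| = (#|X true| * #|X false| * q ^ n.-1)%N.
Proof.
have d_gt0 : (0 < m %/ r)%N by rewrite (divn_gt0 _ (prime_gt0 r_prime)) (dvdn_leq _ r_dvd).
pose F i := if i == ord0 then X true else if i == i1 then X false else [set: gT].
have := @cycle_coord_card _ n (c ^+ r) [set ord0; i1] (m %/ r) d_gt0
          (@mixed_visit) F (mem_cycle c r).
have -> : [set u : W | top u == c ^+ r &
             [forall i, cycle_coord [set ord0; i1] (m %/ r) u i \in F i]] = mixed r.
  apply/setP => u; rewrite !inE; congr (_ && _); apply/forallP/andP => [uF|[u0 u1] i].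
    have := (uF ord0, uF i1); rewrite !ffunE /F !inE !eqxx (negPf i1_neq0) orbT /=.
    by case.
  by rewrite ffunE /F !inE; do 2?case: eqP => [->|] //=; rewrite ?inE.
move=> ->; rewrite (bigD1 ord0) //= (bigD1 i1) ?i1_neq0 //= mulnA.
congr (_ * _ * _)%N; rewrite /F ?eqxx ?(negPf i1_neq0) //.
rewrite (eq_bigr (fun=> q)) => [|i /andP[/negPf-> /negPf->]]; last by rewrite cardsT.
rewrite prod_nat_const; congr (_ ^ _)%N.
have -> : n.-1 = #|~: [set ord0; i1]|.
  by rewrite cardsCs setCK cards2 eq_sym i1_neq0 card_ord subn2.
by rewrite -cardsE; apply: eq_card => i; rewrite !inE negb_or.
Qed.

Lemma mixed_product K u0 v : u0 \in K -> top u0 = c -> v \in K :&: mixed r ->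
   exists x y, [/\ x \in proj K ord0 :&: X true & y \in proj K ord0 :&: X false].
Proof.
move=> Ku0 u0c /setIP[Kv]; rewrite inE => /and3P[/eqP vr v0 v1].
have vK i : coord (v ^+ (m %/ r)) i \in proj K i.
  by rewrite coordX_proj // vr -expgM mulnC divnK // shift_perm_expm.
have [x px] := proj_conj Ku0 u0c i1.
exists (coord (v ^+ (m %/ r)) ord0), (coord (v ^+ (m %/ r)) i1 ^ x^-1).
split; first by rewrite inE vK v0.
rewrite inE -(normX false x^-1) memJ_conjg v1 andbT.
by rewrite -mem_conjg -px.
Qed.

End PrimeLevel.

(** By Bezout some product of a power of [c ^+ r] and a power of [c ^+ s] is c. *)
Lemma mixed_bezout K u v r s : r \in primes m -> s \in primes m -> r != s ->
  u \in K :&: mixed r -> v \in K :&: mixed s -> exists2 g, g \in K & top g = c.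
Proof.
rewrite !mem_primes => /andP[rP _] /andP[sP _] rs /setIP[Ku].
rewrite inE => /andP[/eqP ur _] /setIP[Kv]; rewrite inE => /andP[/eqP vs _].
have co : coprime r s by rewrite prime_coprime // dvdn_prime2.
have [a _ /dvdnP[b E]] := Bezoutl s (prime_gt0 rP).
exists (u ^+ b * v ^- a); first by rewrite groupM ?groupV ?groupX.
rewrite topM ?in_setT // topV !topX ur vs -!expgM (mulnC r) -E (eqP co).
by rewrite expgD (mulnC s) mulgK.
Qed.

Lemma card_gt2 : (2 < q)%N.
Proof.
rewrite ltnNge; apply: contra nabS; rewrite -cardsT leq_eqVlt => /predU1P[q2|q1].
  by rewrite cyclic_abelian // prime_cyclic // q2.
rewrite (card1_trivg (G := [set: gT]%G)) ?abelian1 //.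
by apply/eqP; rewrite eqn_leq -ltnS q1 cardG_gt0.
Qed.

Lemma card_base_part K u0 : u0 \in K -> top u0 = c -> K \proper [set: W] ->
    proj K ord0 = [set: gT] ->
  exists2 k, (0 < k) && (2 * k <= m)%N & (#|base_part K| <= q ^ k)%N.
Proof.
move=> Ku0 u0c ltK proj0.
have projT i : proj K i = [set: gT].
  by have [x ->] := proj_conj Ku0 u0c i; rewrite proj0; apply/normP; rewrite inE subsetT.
have [k km kL] := card_subdirect_le simpleS nabS projT (base_part_single Ku0 u0c simpleS proj0 ltK).
exists k; rewrite ?{1}card_ord in km *; rewrite ?km ?andbT //.
case: k km kL => // _; rewrite expn0 => L1.
have := leq_morphim (dffun_morphism (fun=> gT) ord0) (base_part K).
rewrite -/(proj K ord0) proj0 cardsT => /leq_trans/(_ L1) q1.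
by have := leq_trans card_gt2 q1.
Qed.

(** The order q of the group is at most a quarter of #|A b| * #|A b :&: X b|, and so
    of the square of #|A b|; hence [q ^ k] is negligible with respect to the number
    of elements of [single b] in a subgroup of product type. *)
Lemma diag_single k b : (0 < k)%N -> (2 * k <= m)%N ->
  (4 * q ^ k <= #|A b :&: X b| * #|A b| ^ n)%N.
Proof.
case: k => // k _ km; have qA : (4 * q <= #|A b| * #|A b|)%N.
  by apply: leq_trans (bigA b) _; rewrite leq_mul2l subset_leq_card ?subsetIl ?orbT.
rewrite expnS mulnA.
apply: (@leq_trans (#|A b| * #|A b :&: X b| * (#|A b| * #|A b|) ^ k)).
  rewrite leq_mul ?bigA // leq_expn_base //; apply: leq_trans qA.
  by rewrite leq_pmull.
rewrite (mulnC #|A b|) -mulnA leq_mul2l mulnn -expnM -expnS leq_pexp2l ?cardG_gt0 ?orbT //.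
by move: km; lia.
Qed.

Lemma size_primes_lt : (size (primes m) <= n)%N.
Proof.
rewrite -[n in (_ <= n)%N](size_iota 2); apply: uniq_leq_size (primes_uniq _) _ => p.
by rewrite mem_primes mem_iota => /and3P[/prime_gt1 -> _ pm]; rewrite add2n ltnS (dvdn_leq _ pm).
Qed.

(** What remains to be seen is that m has at most [q ^ (n - k)] prime divisors. *)
Lemma diag_mixed k : (0 < k)%N -> (2 * k <= m)%N ->
  (2 * (size (primes m) * q ^ k) <= #|X true| * #|X false| * q ^ n.-1)%N.
Proof.
move=> k0 km; apply: (@leq_trans (2 * q * q ^ n.-1)%N); last by rewrite leq_mul2r bigX orbT.
rewrite -mulnA leq_mul2l /= -expnS prednK; last by move: km k0; lia.
have kn : (k <= n)%N by move: km k0; lia.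
rewrite -[in leqRHS](subnK kn) expnD leq_mul2r; apply/orP; right.
apply: leq_trans size_primes_lt _.
apply: (@leq_trans (3 ^ (n - k))%N); last by rewrite leq_expn_base ?card_gt2.
apply: (@leq_trans (2 * (n - k)).+1); first by move: km; lia.
by elim: (n - k)%N => // j; rewrite expnS; lia.
Qed.

(** The weight [xw b] of the elements of [single b] is such that the subgroups of
    product type built from conjugates of A b have weight exactly 1. Each
    [mixed r] receives a total weight 1, spread uniformly. *)
Section Weights.
Import Order.TTheory GRing.Theory Num.Theory.
Local Open Scope ring_scope.

Let xw b : rat := (#|A b :&: X b| * #|A b| ^ n)%:R^-1.
Let yw r : rat := #|mixed r|%:R^-1.
Let w (u : W) : rat :=
  \sum_b (u \in single b)%:R * xw b + \sum_(r <- primes m) (u \in mixed r)%:R * yw r.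

Let w_ge0 u : 0 <= w u.
Proof. by rewrite addr_ge0 ?sumr_ge0 // => [b|r] _; rewrite mulr_ge0 ?ler0n ?invr_ge0 ?ler0n. Qed.

Let sum_w (K : {set W}) : \sum_(u in K) w u =
  \sum_b #|K :&: single b|%:R * xw b + \sum_(r <- primes m) #|K :&: mixed r|%:R * yw r.
Proof.
have ind (B : {set W}) (x : rat) : \sum_(u in K) (u \in B)%:R * x = #|K :&: B|%:R * x.
  rewrite -mulr_suml; congr (_ * x); rewrite -sum1_card natr_sum [RHS]big_mkcond [LHS]big_mkcond.
  by apply: eq_bigr => u _; rewrite inE; case: (u \in K); case: (u \in B).
rewrite big_split /= exchange_big; congr (_ + _); first by apply: eq_bigr => b _; exact: ind.
by rewrite exchange_big; apply: eq_bigr => r _; exact: ind.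
Qed.

Lemma inv_natM_le (a b d : nat) : (a * b <= d)%N -> (0 < a)%N -> b%:R * d%:R^-1 <= a%:R^-1 :> rat.
Proof.
move=> abd a0; have [->|d0] := posnP d; first by rewrite invr0 mulr0 invr_ge0 ler0n.
by rewrite ler_pdivrMr ?ltr0n // ler_pdivlMl ?ltr0n // -natrM ler_nat.
Qed.

Lemma natr_div_le1 (b d : nat) : (b <= d)%N -> b%:R * d%:R^-1 <= 1 :> rat.
Proof. by move=> bd; have := @inv_natM_le 1 b d; rewrite mul1n invr1; apply. Qed.

(** A proper subgroup K with no element over c meets at most one of the sets
    [mixed r]. Otherwise the projections of K on the coordinates are conjugate.
    If they are proper, K lies in a subgroup of product type: it meets no
    [mixed r], at most one [single b], and that one not more often than A b
    allows. If they are everything, the base part of K has order at most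
    [q ^ k] with k at most half of m, and so has each of the intersections of K
    with the sets that carry weight: the sets [single b] contribute at most 1/4
    each, and the sets [mixed r] at most 1/2 together. *)
Lemma weight_le1 K : K \proper [set: W] -> \sum_(u in K) w u <= 1.
Proof.
move=> ltK; rewrite sum_w.
have [/existsP[u0 /andP[Ku0 /eqP u0c]]|noc] := boolP [exists u in K, top u == c]; last first.
  have -> : \sum_b #|K :&: single b|%:R * xw b = 0.
    rewrite big1 // => b _; rewrite (_ : K :&: single b = set0) ?cards0 ?mul0r //.
    apply/setP => u; rewrite !inE; apply/negP => /and3P[Ku uc _].
    by case/negP: noc; apply/exists_inP; exists u.
  rewrite add0r.
  have le1 r : #|K :&: mixed r|%:R * yw r <= 1.
    by rewrite natr_div_le1 // subset_leq_card ?subsetIr.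
  have [/hasP[r rm ntr]|/hasPn noR] := boolP (has (fun r => K :&: mixed r != set0) (primes m)).
    rewrite (bigD1_seq r) ?primes_uniq //= big_seq_cond big1 ?addr0 // => s /andP[sm sr].
    rewrite (_ : K :&: mixed s = set0) ?cards0 ?mul0r //; apply/eqP; apply: contraR noc => nts.
    have [[u Ku] [v Kv]] := (set0Pn _ ntr, set0Pn _ nts).
    rewrite eq_sym in sr; have [g Kg gc] := mixed_bezout rm sm sr Ku Kv.
    by apply/exists_inP; exists g; rewrite ?gc.
  rewrite big_seq big1 ?ler01 // => r /noR; rewrite negbK => /eqP->.
  by rewrite cards0 mul0r.
have [projT|ltp] := eqVneq (proj K ord0) [set: gT].
  have [k /andP[k0 km] Lk] := card_base_part Ku0 u0c ltK projT.
  have -> : 1 = (2 * 4^-1 + 2^-1) :> rat by lra.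
  apply: lerD.
    rewrite big_bool /= mulr_natl mulr2n.
    have le4 b : #|K :&: single b|%:R * xw b <= 4^-1.
      apply: (@inv_natM_le 4) => //; apply: leq_trans (diag_single b k0 km).
      rewrite leq_mul2l /=; apply: leq_trans Lk; apply: leq_trans (card_top_fiber K c).
      by apply/subset_leq_card/subsetP => u; rewrite !inE => /and3P[-> -> _].
    by rewrite lerD ?le4.
  have leR r : r \in primes m -> #|K :&: mixed r|%:R * yw r <= (2 * size (primes m))%:R^-1.
    move=> rm; apply: inv_natM_le; last first.
      by rewrite muln_gt0 /=; case: (primes m) rm.
    rewrite card_mixed // -mulnA; apply: leq_trans (diag_mixed k0 km).
    rewrite !leq_mul //; apply: leq_trans Lk; apply: leq_trans (card_top_fiber K (c ^+ r)).
    by apply/subset_leq_card/subsetP => u; rewrite !inE => /and3P[-> -> _].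
  rewrite big_seq.
  apply: (@le_trans _ _ (\sum_(r <- primes m | r \in primes m) (2 * size (primes m))%:R^-1)).
    exact: ler_sum.
  rewrite -big_seq big_const_seq count_predT iter_addr_0.
  case: (size _) => [|s]; first by rewrite mulr0n.
  by rewrite -[leLHS]mulr_natr natrM invfM -mulrA mulVf ?mulr1 ?pnatr_eq0.
have ltp' : proj K ord0 \proper [set: gT] by rewrite properEneq ltp subsetT.
have [b [noX leA leX]] := capX (M := proj_group K ord0) ltp'.
have noXp b' x : x \in proj K ord0 :&: X b' -> b' = b.
  by case: (eqVneq b' b) => // /negbTE; case: b' b noX {leA leX} => [] [] // noX _; rewrite noX inE.
rewrite [X in _ + X]big1_seq ?addr0 => [|r /andP[_ rm]]; last first.
  rewrite (_ : K :&: mixed r = set0) ?cards0 ?mul0r //; apply/setP => v; rewrite [RHS]inE.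
  apply/negP => /(mixed_product rm Ku0 u0c)[x [y [/noXp bt /noXp]]].
  by rewrite -bt.
rewrite (bigD1 b) //= big1 ?addr0 => [|b' bb'].
  by apply: natr_div_le1; apply: card_single_product Ku0 u0c leA leX.
rewrite (_ : K :&: single b' = set0) ?cards0 ?mul0r //; apply/setP => v; rewrite [RHS]inE.
apply/negP => /setIP[Kv]; rewrite inE => /andP[/eqP vc vX].
have : coord (v ^+ m) ord0 \in proj K ord0 :&: X b'.
  by rewrite inE vX coordX_proj // vc shift_perm_expm.
by move/noXp=> bE; rewrite bE eqxx in bb'.
Qed.

Lemma covering_lower_bound P : proper_cover [set: W]%G P ->
  (size (primes m) + #|[set: gT] : A true| ^ m + #|[set: gT] : A false| ^ m <= #|P|)%N.
Proof.
move=> PW; have := fractional_cover PW w_ge0 weight_le1; rewrite sum_w.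
have q0 : (0 < q)%N by apply: ltn_trans card_gt2.
have /andP[Xt0 Xf0] : (0 < #|X true|)%N && (0 < #|X false|)%N.
  by rewrite -muln_gt0; apply: leq_trans bigX; rewrite muln_gt0.
have -> : \sum_b #|[set: W] :&: single b|%:R * xw b = \sum_b (#|[set: gT] : A b| ^ m)%:R :> rat.
  apply: eq_bigr => b _; have AX0 : (0 < #|A b :&: X b|)%N.
    by have := leq_trans _ (bigA b); move/(_ 1%N); rewrite !muln_gt0 q0 => /(_ isT)/andP[].
  rewrite setTI card_single cardX -[q]cardsT -(Lagrange (subsetT (A b))) /xw.
  rewrite [(#|A b| * _)%N]mulnC expnMn mulnACA -expnS natrM mulfK //.
  by rewrite pnatr_eq0 -lt0n muln_gt0 AX0 expn_gt0 cardG_gt0.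
have -> : \sum_(r <- primes m) #|[set: W] :&: mixed r|%:R * yw r = (size (primes m))%:R :> rat.
  rewrite (eq_big_seq (fun=> 1)) => [|r rm].
    by rewrite big_const_seq count_predT iter_addr_0.
  rewrite setTI mulfV // pnatr_eq0 -lt0n card_mixed //.
  by rewrite !muln_gt0 Xt0 Xf0 expn_gt0 q0.
by rewrite big_bool /= -!natrD ler_nat addnC addnA.
Qed.
End Weights.
End LowerBound.

(** * The covering number in terms of two classes of subgroups *)

Lemma wreath_nonabelian (gT : finGroupType) n : ~~ abelian [set: gT] ->
  ~~ abelian [set: wreath_cyclic gT n.+1].
Proof.
apply: contra => /centsP abW; apply/centsP => x _ y _.
have := abW (base_emb [ffun=> x]) (in_setT _) (base_emb [ffun=> y]) (in_setT _).
move=> /(congr1 (fun u => coord u ord0)).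
by rewrite -!base_embM ?in_setT // !coord_base_emb !mulg_ffun !ffunE.
Qed.

Section Sigma.
Variables (gT : finGroupType) (n : nat) (A : bool -> {group gT}) (X : bool -> {set gT}).
Local Notation q := #|gT|.
Hypothesis simpleS : simple [set: gT].
Hypothesis nabS : ~~ abelian [set: gT].
Hypothesis normX : forall b x, X b :^ x = X b.
Hypothesis capX : forall M : {group gT}, M \proper [set: gT] ->
  exists b, [/\ M :&: X (~~ b) = set0, #|M| <= #|A b| & #|M :&: X b| <= #|A b :&: X b|].
Hypothesis cardX : forall b, #|X b| = (#|[set: gT] : A b| * #|A b :&: X b|)%N.
Hypothesis bigA : forall b, (4 * q <= #|A b| * #|A b :&: X b|)%N.
Hypothesis bigX : (2 * q <= #|X true| * #|X false|)%N.
Hypothesis properA : forall b, A b \proper [set: gT].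
Hypothesis coverA : forall x, exists b y, x \in A b :^ y.

(** For a simple group whose covers are governed by two classes of subgroups,
    sigma of the wreath product is what it costs to cover the elements over the
    non generators of the top group and those over the generators. *)
Theorem sigma_wreath_cyclic : sigma [set: wreath_cyclic gT n.+1]%G =
  (size (primes n.+1) + #|[set: gT] : A true| ^ n.+1 + #|[set: gT] : A false| ^ n.+1)%N.
Proof.
have ncyc : ~~ cyclic [set: wreath_cyclic gT n.+1].
  by apply: contra (wreath_nonabelian n nabS) => /cyclic_abelian.
have [[P Pcov <-] minP] := sigmaP (G := [set: wreath_cyclic gT n.+1]%G) ncyc.
have [Q Qcov cQ] := covering_upper_bound n properA coverA.
apply/eqP; rewrite eqn_leq.
rewrite (covering_lower_bound simpleS nabS normX capX cardX bigA bigX Pcov) andbT.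
exact: leq_trans (minP Q Qcov) cQ.
Qed.
End Sigma.

(** * Elements of given order in permutation groups *)

Definition of_order (gT : finGroupType) k : {set gT} := [set z | #[z] == k].
Arguments of_order {gT} k.

Section ConjugateCyclic.
Variables (gT : finGroupType) (H : {group gT}) (x : gT).
Hypothesis Hx : x \in H.
Hypothesis conjx : {in H :&: of_order #[x], forall z, exists2 y, y \in H & <[z]> = <[x]> :^ y}.

(** Every cyclic subgroup of order [#[x]] in H is a conjugate of [<[x]>], and each
    has [totient #[x]] generators. *)
Lemma card_of_order : #|H :&: of_order #[x]| = (totient #[x] * #|H : 'N_H(<[x]>)|)%N.
Proof.
rewrite -card_conjugates -sum1_card.
rewrite (partition_big (fun z => <[z]>) [in <[x]> :^: H]) /=; last first.
  by move=> z /conjx[y Hy ->]; rewrite imset_f.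
rewrite mulnC -sum_nat_const; apply: eq_bigr => _ /imsetP[y Hy ->].
rewrite sum1dep_card totient_gen -[RHS](cardJg _ y); apply: eq_card => z.
rewrite !inE mem_conjg inE /generator; apply/andP/eqP=> [[_ /eqP E]|E].
  by rewrite cycleJ E conjsgK.
have Ez : <[z]> = <[x]> :^ y by rewrite E cycleJ conjsgKV.
split; last by rewrite Ez.
rewrite -cycle_subG Ez -{1}(conjGid Hy) conjSg cycle_subG Hx /=.
by rewrite orderE Ez cardJg.
Qed.
End ConjugateCyclic.

Section PrimeDegree.

Variables (n : nat) (x : 'S_n).
Hypotheses (n_prime : prime n) (xn : #[x] = n).

(** Some point is moved by x, and the size of its orbit divides n. *)
Lemma prime_cycle_trans i j : exists k, (x ^+ k) i = j.
Proof.
have n_gt1 := prime_gt1 n_prime.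
have ntx : x != 1 by rewrite -order_eq1 xn -(ltn_predK n_gt1) eqSS -lt0n -ltnS (ltn_predK n_gt1).
have orb_dvd l : #|orbit 'P <[x]> l| %| n.
  by have := dvdn_orbit 'P <[x]> l; rewrite -orderE xn.
have [l xl] : exists l, x l != l.
  apply/existsP; apply: contraR ntx => /existsPn fx; apply/eqP/permP => l.
  by rewrite perm1; apply/eqP; rewrite -[_ == _]negbK fx.
have orbT : orbit 'P <[x]> l = setT.
  apply/eqP; rewrite eqEcard subsetT cardsT card_ord.
  have /primeP[_ /(_ _ (orb_dvd l))] := n_prime.
  case/pred2P=> [/eqP/cards1P[l' lE]|->]; last by rewrite leqnn.
  have := orbit_refl 'P <[x]> l; have := mem_orbit 'P l (cycle_id x).
  by rewrite lE !inE /= /aperm => /eqP xl' /eqP ll'; rewrite xl' ll' eqxx in xl.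
have [/orbitP[_ /cycleP[a ->] ai] /orbitP[_ /cycleP[b ->] bj]] :
    i \in orbit 'P <[x]> l /\ j \in orbit 'P <[x]> l by rewrite orbT !inE.
rewrite /= /aperm in ai bj.
(* as x has order n, the power a * n.-1 is the inverse of the power a *)
exists (a * n.-1 + b)%N.
rewrite -bj -ai -permM -expgD addnA -mulnS prednK ?prime_gt0 // expgD mulnC expgM.
by have := expg_order x; rewrite xn => ->; rewrite expg1n mul1g.
Qed.

Lemma prime_cycle_nofix i : x i != i.
Proof.
apply/eqP => xi; have : #[x] == 1%N.
  rewrite order_eq1; apply/eqP/permP => j; have [k <-] := prime_cycle_trans i j.
  by rewrite perm1 -!permM -expgSr expgS permM xi.
by rewrite xn => /eqP n1; have := prime_gt1 n_prime; rewrite n1.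
Qed.

(** A permutation that commutes with a transitive x is determined by the image of
    one point. *)
Lemma cent_prime_cycle (H : {group 'S_n}) : #|'C_H[x]| <= n.
Proof.
have n_gt0 := prime_gt0 n_prime; pose i0 := Ordinal n_gt0.
have inj : {in 'C_H[x] &, injective (fun z : 'S_n => z i0)}.
  move=> z t /setIP[_ /cent1P zx] /setIP[_ /cent1P tx] /= zt; apply/permP => i.
  have [k <-] := prime_cycle_trans i0 i.
  have comm_k y : commute x y -> y ((x ^+ k) i0) = (x ^+ k) (y i0).
    by move=> xy; rewrite -!permM (commuteX k (commute_sym xy)).
  by rewrite !comm_k ?zt.
by rewrite -(card_in_imset inj) (leq_trans (max_card _)) ?card_ord.
Qed.

End PrimeDegree.

(** The normalizer permutes the generators of [<[x]>], and the stabilizer of x is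
    its centralizer. *)
Lemma norm_cycle_le (gT : finGroupType) (H : {group gT}) (x : gT) :
  #|'N_H(<[x]>)| <= totient #[x] * #|'C_H[x]|.
Proof.
have sub : 'C_H[x] \subset 'N_H(<[x]>) by rewrite setIS // -cent_cycle cent_sub.
rewrite mulnC -(Lagrange sub) leq_mul2l; apply/orP; right.
have E : 'C_('N_H(<[x]>))[x] = 'C_H[x].
  by apply/eqP; rewrite eqEsubset setSI ?subsetIl //= subsetI sub subsetIr.
have := index_cent1 'N_H(<[x]>)%G x; rewrite /= E totient_gen => ->.
apply/subset_leq_card/subsetP => _ /imsetP[y Ny ->].
have /setIP[_ /normP Nyx] := Ny.
by rewrite inE /generator cycleJ Nyx.
Qed.

(** Two cyclic subgroups of order 8 in a group of order at most 16 share at least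
    4 elements, hence [z ^+ 2], which is then centralized by both; the
    centralizer is too small for them to be distinct. *)
Lemma cycle8_unique (gT : finGroupType) (P : {group gT}) z t : #|P| <= 16 ->
    z \in P -> t \in P -> #[z] = 8 -> #[t] = 8 -> #|'C_P[z ^+ 2]| <= 8 ->
  <[t]> = <[z]>.
Proof.
move=> P16 Pz Pt z8 t8 C8.
have z24 : #[z ^+ 2] = 4 by rewrite orderXdiv z8.
have D4 : 4 %| #|<[z]> :&: <[t]>|.
  have : #|<[z]> :&: <[t]>| \in divisors 8.
    by have := cardSg (subsetIl <[z]> <[t]>); rewrite -orderE z8 -dvdn_divisors.
  have := mul_cardG <[z]> <[t]>; rewrite -!orderE z8 t8 => E.
  have ZT : #|<[z]> * <[t]>| <= 16.
    by apply: leq_trans P16; rewrite subset_leq_card // mul_subG ?cycle_subG.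
  rewrite (_ : divisors 8 = [:: 1; 2; 4; 8]%N) // !inE.
  by move: E ZT; move: #|<[z]> * <[t]>| => a E ZT /or4P[]/eqP dE; rewrite dE //= in E *; lia.
have : z ^+ 2 \in <[z]> :&: <[t]>.
  rewrite -cycle_subG -(cardSg_cyclic (cycle_cyclic z)) ?subsetIl ?cycle_subG ?mem_cycle //.
  by rewrite -orderE z24.
case/setIP=> _ z2t.
have CE : <[z]> = 'C_P[z ^+ 2].
  apply/eqP; rewrite eqEcard -orderE z8 C8 andbT cycle_subG inE Pz /=.
  by apply/cent1P; apply: commuteX.
have : t \in <[z]>.
  rewrite CE inE Pt; apply/cent1P.
  by have /cycleP[k ->] := z2t; rewrite /commute -expgS -expgSr.
by rewrite -cycle_subG => tz; apply/eqP; rewrite eqEcard tz -!orderE t8 z8.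
Qed.

(** The orbits of a normal subgroup of a transitive group have equal sizes, so in
    prime degree they are single points or everything. *)
Lemma normal_prime_degree n (G T : {group 'S_n}) : prime n ->
    (forall i, orbit 'P G i = setT) -> T <| G -> T :=: 1 \/ n %| #|T|.
Proof.
move=> n_prime transG /andP[sTG nTG].
have orbJ x i : x \in G -> #|orbit 'P T (x i)| = #|orbit 'P T i|.
  move=> Gx; rewrite -[RHS](card_imset _ (@perm_inj _ x)); apply: eq_card => j.
  have := orbit_conjsg 'P T x i (x^-1 j).
  rewrite (normsP nTG x Gx) /= /aperm permKV => ->.
  apply/idP/imsetP => [ij|[k ik ->]]; last by rewrite permK.
  by exists (x^-1 j); rewrite ?permKV.
have orb_eq i j : #|orbit 'P T i| = #|orbit 'P T j|.
  have /orbitP[x Gx <-] : i \in orbit 'P G j by rewrite transG inE.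
  exact: orbJ.
have [/forallP fixT|] := boolP [forall i, #|orbit 'P T i| == 1%N].
  left; apply/trivgP/subsetP => t Tt; rewrite inE; apply/eqP/permP => i.
  have /cards1P[j orbi] := fixT i; rewrite perm1.
  have := orbit_refl 'P T i; have := mem_orbit 'P i Tt.
  by rewrite orbi !inE /= /aperm => /eqP-> /eqP ij.
case/forallPn=> i ni; right.
have : \sum_(O in orbit 'P T @: setT) #|O| = n.
  rewrite acts_sum_card_orbit ?cardsT ?card_ord //.
  by apply/actsP => t _ j; rewrite !inE.
rewrite (eq_bigr (fun=> #|orbit 'P T i|)) => [|_ /imsetP[j _ ->]]; last exact: orb_eq.
rewrite sum_nat_const => En; have : #|orbit 'P T i| %| n by rewrite -[X in _ %| X]En dvdn_mull.
have /primeP[_ pr] := n_prime; case/pr/pred2P=> E; first by rewrite E in ni.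
by have := dvdn_orbit 'P T i; rewrite E.
Qed.

Local Notation c := (shift_perm 11).
Local Notation g := M11_gen.
Local Notation p := (inord 2 : 'I_11).

(** * Enumeration of M11 *)

Section Enumeration.

Implicit Types (x y z : 'S_11) (s t : seq nat) (w : seq bool).

(** A permutation as the list of its values: products of such lists can be
    evaluated, unlike those of elements of 'S_11. *)
Definition code x : seq nat := [seq val (x i) | i <- enum 'I_11].
Definition pcomp s t : seq nat := [seq nth 0%N t i | i <- s].

Lemma nth_code x (i : 'I_11) : nth 0%N (code x) i = x i :> nat.
Proof.
rewrite (nth_map ord0) ?size_enum_ord //; congr (val (x _)).
exact: nth_ord_enum.
Qed.

Lemma code_inj : injective code.
Proof. by move=> x y xy; apply/permP => i; apply: val_inj; rewrite /= -!nth_code xy. Qed.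

Lemma codeM x y : code (x * y) = pcomp (code x) (code y).
Proof.
rewrite /pcomp [code x]/code [code (x * y)]/code -map_comp.
by apply: eq_map => i; rewrite /= permM nth_code.
Qed.

Lemma codeE x s : size s = 11 -> (forall i : 'I_11, nth 0%N s i = x i :> nat) -> code x = s.
Proof.
move=> ss sx; apply: (@eq_from_nth _ 0%N) => [|i]; first by rewrite size_map size_enum_ord ss.
rewrite size_map size_enum_ord => lti.
by rewrite -[i]/(val (Ordinal lti)) nth_code sx.
Qed.

Definition c_code : seq nat := [:: 1; 2; 3; 4; 5; 6; 7; 8; 9; 10; 0]%N.
Definition g_code : seq nat := [:: 0; 1; 6; 9; 5; 3; 10; 2; 8; 4; 7]%N.

Lemma code_c : code c = c_code.
Proof. by apply: codeE => // i; rewrite permE /=; case: i; do 11?[case=> //]. Qed.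

Lemma tperm_inord n a b (i : 'I_n.+1) : (a <= n)%N -> (b <= n)%N ->
  tperm (inord a) (inord b) i =
    (if i == a :> nat then b else if i == b :> nat then a else i) :> nat.
Proof.
move=> an bn; rewrite permE /= -!val_eqE /= !inordK //.
by case: ifP => _; [|case: ifP => _]; rewrite ?inordK.
Qed.

Lemma code_g : code g = g_code.
Proof.
apply: codeE => // i; rewrite /M11_gen /cycle4 !permM !tperm_inord //.
by case: i => i lti /=; do 11?[case: i lti => //= i lti].
Qed.

Definition word w : 'S_11 := \prod_(b <- w) if b then g else c.
Definition word_code w :=
  foldr (fun b : bool => pcomp (if b then g_code else c_code)) (iota 0 11) w.

Lemma code1 : code 1 = iota 0 11.
Proof. by apply: codeE => // i; rewrite perm1 nth_iota. Qed.

Lemma code_word w : code (word w) = word_code w.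
Proof.
rewrite /word; elim: w => [|b w IH]; first by rewrite big_nil code1.
by rewrite big_cons codeM IH; case: b; rewrite ?code_c ?code_g.
Qed.

Lemma M11c : c \in M11. Proof. by rewrite mem_gen ?set21. Qed.
Lemma M11g : g \in M11. Proof. by rewrite mem_gen ?set22. Qed.
Lemma M11_word w : word w \in M11.
Proof. by apply: group_prod => b _; case: b; rewrite (M11c, M11g). Qed.

Fixpoint code_pow s k := if k is k'.+1 then pcomp (code_pow s k') s else iota 0 11.
Lemma code_powE x k : code (x ^+ k) = code_pow (code x) k.
Proof. by elim: k => [|k IH]; rewrite ?code1 // expgSr codeM IH. Qed.

(** Codes of the products of powers w ^+ i with i < k, one factor for each pair
    (w, k). *)
Fixpoint power_products (l : seq (seq bool * nat)) : seq (seq nat) :=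
  if l is (w, k) :: l' then
    [seq pcomp s t | s <- [seq code_pow (word_code w) i | i <- iota 0 k], t <- power_products l']
  else [:: iota 0 11].

Lemma power_products_sub l s : s \in power_products l -> exists2 x, x \in M11 & code x = s.
Proof.
elim: l s => [|[w k] l IH] s /=; first by rewrite inE => /eqP->; exists 1; rewrite ?code1.
case/allpairsP=> -[_ t] /= [/mapP[i _ ->] /IH[x Mx <-] ->].
by exists (word w ^+ i * x); rewrite ?groupM ?groupX ?M11_word // codeM code_powE code_word.
Qed.

(** A factorization of the stabilizer of 2 in M11 into powers of five elements of
    orders 5, 4, 4, 3, 3, found by a search; [true] stands for [M11_gen] and
    [false] for the 11-cycle. *)
Definition stab_codes := power_products
  [:: ([:: true; true; true; false; false; false; true; true], 5);
      ([:: true; true; false; false; true; true; true; false], 4);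
      ([:: false; false; true; false; false; true], 4);
      ([:: false; false; true; true; false; false; true; true; false; true; true], 3);
      ([:: true; false; true], 3)].

(** Sorting the codes by the image of 0 makes the membership tests below about
    ten times faster. *)
Definition bucket k := [seq s <- stab_codes | nth 0%N s 0 == k].

(** The Schreier generators of the stabilizer of 2 for the transversal formed by
    the powers of c: [c ^+ k * g] sends 2 to some j, and c to the power 13 - j,
    with 13 = 2 + 11, brings j back to 2. *)
Definition schreier k :=
  pcomp (pcomp (code_pow c_code k) g_code)
        (code_pow c_code ((2 + 11) - nth 0%N g_code ((2 + k) %% 11))).

Definition stab_closed :=
  let bs := [seq bucket k | k <- iota 0 11] in
  all (fun k => let h := schreier k in
    all (fun s => let t := pcomp s h in t \in nth [::] bs (nth 0%N t 0)) stab_codes) (iota 0 11).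

Lemma stab_closedT : stab_closed. Proof. by vm_cast_no_check (erefl true). Qed.

Lemma stab_codeP s : s \in stab_codes -> exists2 x, x \in M11 & code x = s.
Proof. exact: power_products_sub. Qed.

(* Keeps the unifier from enumerating the 720 permutations. *)
Opaque stab_codes.

Lemma stab_codes_closed k s : (k < 11)%N -> s \in stab_codes -> pcomp s (schreier k) \in stab_codes.
Proof.
move=> k11 Ls; have /allP/(_ k) := stab_closedT; rewrite mem_iota => /(_ k11).
move=> /allP/(_ s Ls); set t := pcomp s _; cbv zeta.
have [lt_t|ge_t] := ltnP (nth 0%N t 0) 11.
  by rewrite (nth_map 0%N) ?size_iota // nth_iota // mem_filter => /andP[].
by rewrite nth_default ?size_map ?size_iota.
Qed.

Lemma code_schreier k : code (c ^+ k * g * c ^+ (13 - nth 0%N g_code ((2 + k) %% 11))) = schreier k.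
Proof. by rewrite 2!codeM !code_powE code_c code_g. Qed.

(** The products of a listed permutation and a power of c are closed under right
    multiplication by the two generators: this is the lemma of Schreier. *)
Lemma M11_factor x : x \in M11 -> exists y k, code y \in stab_codes /\ x = y * c ^+ k.
Proof.
case/gen_prodgP=> n [h hX ->]; elim: n => [|n IH] in h hX *.
  exists 1, 0%N; rewrite big_ord0 expg0 mulg1 code1; split; last by [].
  by vm_cast_no_check (erefl true).
rewrite big_ord_recr /=; have [i|y [k [Ly ->]]] := IH (fun i => h (widen_ord (leqnSn n) i)).
  exact: hX.
have /set2P[->|->] := hX ord_max.
  by exists y, k.+1; rewrite expgSr mulgA.
pose l := (k %% 11)%N; have -> : c ^+ k = c ^+ l.
  by rewrite expg_mod ?shift_perm_expm.
pose d := (13 - nth 0%N g_code ((2 + l) %% 11))%N.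
(* as c has order 11, c ^+ (d * 10) is the inverse of c ^+ d *)
exists (y * (c ^+ l * g * c ^+ d)), (d * 10)%N; split.
  by rewrite codeM code_schreier stab_codes_closed ?ltn_pmod.
have cd : c ^+ d * c ^+ (d * 10) = 1.
  by rewrite -expgD -mulnS mulnC expgM shift_perm_expm expg1n.
(* M11_gen is itself a product, which associativity would take apart *)
by move: M11_gen => G; rewrite -!mulgA cd mulg1.
Qed.

Lemma stab_codes_fix : all (fun s => nth 0%N s 2 == 2) stab_codes.
Proof. by vm_cast_no_check (erefl true). Qed.

Lemma stab_code x : x \in M11 -> x p = p -> code x \in stab_codes.
Proof.
case/M11_factor=> y [k [Ly ->]] /(congr1 val); rewrite permM /= shift_permX.
have -> : y p = p.
  apply: val_inj; rewrite /= -nth_code inordK //.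
  by apply/eqP; have /allP := stab_codes_fix; apply.
rewrite inordK // => E.
have /eqP := E; rewrite -[X in _ == X]/((2 + 0) %% 11)%N eqn_modDl mod0n => /dvdnP[e ->].
by rewrite mulnC expgM shift_perm_expm expg1n mulg1.
Qed.

Lemma card_M11_stab : #|'C_M11[p | 'P]| = 720.
Proof.
have /andP[uniqL /eqP sizeL] : uniq stab_codes && (size stab_codes == 720).
  by vm_cast_no_check (erefl true).
apply: etrans sizeL; rewrite cardE -(size_map code).
apply: perm_size; apply: uniq_perm uniqL _; first by rewrite (map_inj_uniq code_inj) enum_uniq.
move=> s; apply/mapP/idP => [[x + ->]|Ls].
  rewrite mem_enum => /setIP[Mx /astab1P px]; exact: stab_code.
have [x Mx xs] := stab_codeP Ls; exists x => //.
rewrite mem_enum inE Mx; apply/astab1P; apply: val_inj; rewrite /= -nth_code xs inordK //.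
by apply/eqP; have /allP := stab_codes_fix; apply.
Qed.

Lemma M11_trans : orbit 'P M11 p = setT.
Proof.
(* 2 + 9 is 0 modulo 11 *)
apply/setP => i; rewrite inE; apply/orbitP; exists (c ^+ (9 + i)).
  by rewrite groupX ?M11c.
apply: val_inj; rewrite /= /aperm shift_permX inordK // addnA.
by rewrite -[(2 + 9)%N]/11 modnDl modn_small.
Qed.

Lemma card_M11 : #|M11| = 7920.
Proof. by rewrite -(card_orbit_stab 'P M11 p) M11_trans cardsT card_ord card_M11_stab. Qed.

Lemma stab_codes_regular :
  all (fun s => [&& nth 0 s 6 == 6, nth 0 s 10 == 10 & nth 0 s 7 == 7] ==>
         (s == iota 0 11))%N stab_codes.
Proof. by vm_cast_no_check (erefl true). Qed.

(** A trace of the sharp 4-transitivity of M11; the four points form a cycle of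
    [M11_gen]. *)
Lemma M11_four_points x : x \in M11 ->
  {in [:: 2; 6; 10; 7]%N, forall k, x (inord k) = inord k} -> x = 1.
Proof.
move=> Mx fx; apply: code_inj; rewrite code1.
have := allP stab_codes_regular _ (stab_code Mx (fx 2 isT)).
have fix_k k : k \in [:: 2; 6; 10; 7]%N -> (k < 11)%N -> nth 0%N (code x) k = k.
  by move=> ks k11; rewrite -[k in LHS](inordK k11) nth_code fx ?inordK.
by rewrite !fix_k //= => /eqP.
Qed.

Definition pinv s := [seq index i s | i <- iota 0 11].

Lemma code_inv x : code x^-1 = pinv (code x).
Proof.
apply: codeE => [|i]; first by rewrite size_map size_iota.
rewrite (nth_map 0%N) ?size_iota // nth_iota //= add0n.
have xinj : injective (fun j => val (x j)) by move=> j k /val_inj/perm_inj.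
have := index_map xinj (enum 'I_11) (x^-1 i).
by rewrite permKV index_enum_ord.
Qed.

(** * The subgroup PSL(2, 11) and the cover of M11 *)

(** The translates of the set of quadratic non residues modulo 11 are the blocks
    of a biplane; its automorphism group PSL(2, 11) is contained in M11. *)
Definition biplane : seq (seq nat) :=
  [seq [seq (b + k) %% 11 | b <- [:: 2; 6; 7; 8; 10]] | k <- iota 0 11]%N.

Definition preserves s :=
  all (fun B => has (fun B' => all (fun b => nth 0%N s b \in B') B) biplane) biplane.

Lemma preservesM s t : size s = 11 -> preserves s -> preserves t -> preserves (pcomp s t).
Proof.
move=> ss /allP ps /allP pt; apply/allP => B BB.
have /hasP[B1 B1B /allP sB] := ps B BB; have /hasP[B2 B2B /allP tB] := pt B1 B1B.
apply/hasP; exists B2 => //; apply/allP => b Bb.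
rewrite (nth_map 0%N) ?tB ?sB // ss.
by have /mapP[k _ E] := BB; move: Bb; rewrite E => /mapP[b' _ ->]; rewrite ltn_mod.
Qed.

Lemma size_code x : size (code x) = 11. Proof. by rewrite size_map size_enum_ord. Qed.

Definition L2_11 := [set x in M11 | preserves (code x)].
Lemma L2_11_group_set : group_set L2_11.
Proof.
apply/group_setP; split=> [|x y]; first by rewrite inE group1 code1.
rewrite !inE => /andP[Mx px] /andP[My py].
by rewrite groupM //= codeM preservesM ?size_code.
Qed.
Canonical L2_11_group := Group L2_11_group_set.

Lemma L2_11c : c \in L2_11. Proof. by rewrite inE M11c code_c. Qed.
Lemma L2_11g2 : g ^+ 2 \in L2_11.
Proof. by rewrite inE groupX ?M11g // code_powE code_g. Qed.
Lemma L2_11g : g \notin L2_11. Proof. by rewrite inE M11g code_g. Qed.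

Lemma order_c : #[c] = 11. Proof. exact: order_shift_perm. Qed.

Lemma Sylow_c : 11.-Sylow(M11) <[c]>.
Proof.
by rewrite pHallE cycle_subG M11c -orderE order_c card_M11 p_part.
Qed.

Definition fpf s := all (fun i => nth 0%N s i != i) (iota 0 11).

(** Up to conjugacy an element of M11 that moves 2 sends it to 3, so it is the
    product of an element of the stabilizer of 2 and c. If it fixes no point then
    it has order 11 or 6, and in the second case it preserves an image of the
    biplane. *)
Definition cover_check := all (fun s => let z := pcomp s c_code in
   fpf z ==> ((code_pow z 11 == iota 0 11) ||
     has (fun t => preserves (pcomp (pcomp t z) (pinv t))) stab_codes)) stab_codes.

Lemma cover_checkT : cover_check.
Proof.
(* By lazy evaluation, which unlike call by value stops at the first witness. *)
exact_no_check (erefl true).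
Qed.

Definition two_trans_check :=
  all (fun i => (i == 2) || has (fun s => nth 0%N s i == 3) stab_codes) (iota 0 11).
Lemma two_trans_checkT : two_trans_check. Proof. by vm_cast_no_check (erefl true). Qed.

(** Every element of M11 has a fixed point among the 11 points or among the 12
    cosets of PSL(2, 11). *)
Lemma M11_cover z : z \in M11 ->
  (exists2 x, x \in M11 & z \in 'C_M11[p | 'P] :^ x) \/ (exists2 x, x \in M11 & z \in L2_11 :^ x).
Proof.
move=> Mz; have [/existsP[i /eqP zi]|nfix] := boolP [exists i, z i == i].
  left; have /orbitP[x Mx xp] : i \in orbit 'P M11 p by rewrite M11_trans inE.
  exists x => //; rewrite mem_conjg inE groupJ ?groupV //=; apply/astab1P.
  by rewrite /= /aperm conjgE invgK !permM [x p]xp zi -xp /aperm permK.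
right; have zp : z p != p by apply: contra nfix => zp; apply/existsP; exists p.
have [x Mx [xp xz]] : exists2 x, x \in M11 & x p = p /\ x (z p) = 3 :> nat.
  have /allP/(_ (z p)) := two_trans_checkT; rewrite mem_iota ltn_ord => /(_ isT).
  have -> : (z p == 2 :> nat) = false.
    by apply: contraNF zp => /eqP zp; apply/eqP/val_inj; rewrite /= zp inordK.
  rewrite orFb => /hasP[s Ls /eqP s3]; have [x Mx xs] := stab_codeP Ls; exists x => //; split.
    apply/val_inj; rewrite /= -nth_code xs inordK //.
    by apply/eqP; have /allP := stab_codes_fix; apply.
  by rewrite -nth_code xs.
pose y := z ^ x; have My : y \in M11 by rewrite groupJ.
suff [t Mt yt] : exists2 t, t \in M11 & y ^ t \in L2_11.
  exists (x * t)^-1; first by rewrite groupV groupM.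
  by rewrite mem_conjgV conjgM.
have y3 : y p = 3 :> nat by rewrite /y conjgE !permM -{1}xp permK.
have Lyc : code (y * c^-1) \in stab_codes.
  apply: stab_code; first by rewrite groupM ?groupV ?M11c.
  apply: (@perm_inj _ c); rewrite permM permKV; apply: val_inj.
  by rewrite /= y3 -nth_code code_c inordK.
have := allP cover_checkT _ Lyc; cbv zeta; rewrite -code_c -codeM mulgKV.
have -> : fpf (code y).
  apply/allP => i; rewrite mem_iota => /andP[_ lti].
  apply: contra nfix => /eqP yi; apply/existsP; exists (x^-1 (Ordinal lti)).
  have /eqP : y (Ordinal lti) = Ordinal lti by apply/val_inj; rewrite /= -nth_code.
  rewrite /y conjgE !permM => /eqP E; apply/eqP/(@perm_inj _ x).
  by rewrite permKV.
rewrite implyTb => /orP[/eqP y11|/hasP[s Ls]].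
  have sylc := Sylow_c; have y11' : 11.-group <[y]>.
    have : y ^+ 11 = 1 by apply: code_inj; rewrite code_powE y11 code1.
    move/eqP; rewrite -order_dvdn /pgroup -orderE => /pnat_dvd; apply.
    by rewrite pnat_id.
  have sYM : <[y]> \subset M11 by rewrite cycle_subG.
  have [t Mt] := Sylow_subJ sylc sYM y11'; rewrite cycle_subG => yt.
  exists t^-1; first by rewrite groupV.
  by move: yt; rewrite mem_conjg; apply/subsetP; rewrite cycle_subG L2_11c.
have [t Mt <-] := stab_codeP Ls; rewrite -code_inv -!codeM => pr.
exists t^-1; first by rewrite groupV.
by rewrite inE groupJ ?groupV // conjgE invgK mulgA.
Qed.

End Enumeration.

(** * Elements of order 11 and simplicity *)

Lemma card_M11_dvd : #|M11| = (720 * 11)%N. Proof. exact: card_M11. Qed.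

Lemma Sylow_order11 (H : {group 'S_11}) x :
  H \subset M11 -> x \in H -> #[x] = 11 -> 11.-Sylow(H) <[x]>.
Proof.
move=> sHM Hx x11.
have sylx : 11.-Sylow(M11) <[x]>.
  rewrite pHallE cycle_subG (subsetP sHM) // -orderE x11.
  have := card_Hall Sylow_c; rewrite -orderE order_c => <-.
  by apply/eqP; rewrite -x11.
apply: pHall_subl sylx => //; first by rewrite cycle_subG.
Qed.

Lemma card_order11 (H : {group 'S_11}) x : H \subset M11 -> x \in H -> #[x] = 11 ->
  #|H :&: of_order 11| = (10 * #|H : 'N_H(<[x]>)|)%N /\ #|H : 'N_H(<[x]>)| = 1 %[mod 11].
Proof.
move=> sHM Hx x11; have sylx := Sylow_order11 sHM Hx x11; split.
  have := card_of_order Hx; rewrite x11 => -> //.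
  move=> z /setIP[Hz]; rewrite inE => /eqP z11.
  exact: Sylow_trans sylx (Sylow_order11 sHM Hz z11).
by rewrite -(card_Syl sylx) card_Syl_mod.
Qed.

(** The generators of a group of order 11 number 10, and its centralizer in degree
    11 is the group itself. *)
Lemma card_norm11 (H : {group 'S_11}) x : H \subset M11 -> x \in H -> #[x] = 11 ->
  exists2 e, (0 < e <= 10)%N & #|'N_H(<[x]>)| = (11 * e)%N.
Proof.
move=> sHM Hx x11.
have sxN : <[x]> \subset 'N_H(<[x]>) by rewrite subsetI cycle_subG Hx normG.
exists #|'N_H(<[x]>) : <[x]>|; last by rewrite -(Lagrange sxN) -orderE x11.
rewrite indexg_gt0 /= -(leq_pmul2l (isT : 0 < 11)%N) -{1}x11 orderE Lagrange //.
apply: leq_trans (norm_cycle_le H x) _.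
by rewrite x11 mulnC leq_mul // cent_prime_cycle.
Qed.

(** The index of the normalizer is 720 / e with e at most 10, and congruent to 1
    modulo 11 by Sylow; only e = 5 is possible. *)
Lemma card_norm11_M11 x : x \in M11 -> #[x] = 11 ->
  #|'N_M11(<[x]>)| = 55 /\ #|M11 : 'N_M11(<[x]>)| = 144.
Proof.
move=> Mx x11; have [e e10 Ne] := card_norm11 (subxx _) Mx x11.
have [_ n1] := card_order11 (subxx _) Mx x11.
have := Lagrange (subsetIl M11 'N(<[x]>)); rewrite Ne card_M11_dvd.
move: n1; move: #|_ : _| => k k1 E.
have {}E : (e * k = 720)%N by lia.
have {}k1 : k = (11 * (k %/ 11) + 1)%N by rewrite {1}(divn_eq k 11) k1 mulnC.
suff [-> ->] : e = 5 /\ k = 144 by [].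
move: (k %/ 11) k1 => t k1 {Ne}.
do 11?[case: e e10 E => [|e] e10 E; first by lia].
lia.
Qed.

(** If the Sylow 11-subgroups of H are self-normalizing then there are just as
    many elements of other orders as there are elements in a point stabilizer,
    and the latter are among the former. So all point stabilizers coincide, and
    they are trivial. *)
Lemma index_self_normalizing11 (H : {group 'S_11}) x : H \subset M11 -> x \in H -> #[x] = 11 ->
   #|'N_H(<[x]>)| = 11 -> #|H : 'N_H(<[x]>)| = 1%N.
Proof.
move=> sHM Hx x11 Nx; have [T10 _] := card_order11 sHM Hx x11.
have := Lagrange (subsetIl H 'N(<[x]>)); rewrite Nx.
move: T10; move: #|_ : _| => k T10 Hk.
have pr11 : prime 11 by [].
pose U := H :\: of_order 11.
have Uk : #|U| = k.
  by apply/eqP; rewrite -(eqn_add2l (10 * k)) -{1}T10 cardsID -Hk mulSnr.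
have stabU i : 'C_H[i | 'P] = U.
  apply/eqP; rewrite eqEcard Uk; apply/andP; split.
    apply/subsetP => y /setIP[Hy /astab1P yi]; rewrite !inE Hy andbT.
    by apply/eqP => /(prime_cycle_nofix pr11)/(_ i)/eqP; apply.
  have := card_orbit_stab 'P H i.
  have -> : orbit 'P H i = setT.
    apply/setP => j; rewrite inE; apply/orbitP.
    by have [a <-] := prime_cycle_trans pr11 x11 i j; exists (x ^+ a); rewrite ?groupX.
  by rewrite cardsT card_ord -Hk => /eqP; rewrite eqn_pmul2l // => /eqP->; rewrite leqnn.
rewrite -Uk -(stabU ord0) (_ : 'C_H[ord0 | 'P] = 1) ?cards1 //.
apply/trivgP/subsetP => y Cy; have Uy : y \in U by rewrite -(stabU ord0).
rewrite inE; apply/eqP/permP => i.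
by rewrite perm1; move: Uy; rewrite -(stabU i) => /setIP[_ /astab1P].
Qed.

(** The order of the normalizer of [<[x]>] in H is 11, and then H is [<[x]>], or it
    is 55. In the second case the number of conjugates divides 144 and is
    congruent to 1 modulo 11, so that it is 1, 12 or 144. *)
Lemma M11_subgroup_order11 (H : {group 'S_11}) x : H \subset M11 -> x \in H -> #[x] = 11 ->
  [\/ H :=: M11, #|H| \in [:: 11; 55] /\ #|H :&: of_order 11| = 10
    | #|H| = 660 /\ #|H :&: of_order 11| = 120].
Proof.
move=> sHM Hx x11; have [e e10 Ne] := card_norm11 sHM Hx x11.
have [T10 k1] := card_order11 sHM Hx x11.
have [NM _] := card_norm11_M11 (subsetP sHM x Hx) x11.
have cyc1 := index_self_normalizing11 sHM Hx x11.
have e5 : (11 * e %| 55)%N by rewrite -Ne -NM cardSg // setSI.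
have Hk := Lagrange (subsetIl H 'N(<[x]>)); rewrite Ne in Hk.
have dvH := cardSg sHM; rewrite card_M11_dvd -Hk in dvH.
rewrite Ne in cyc1; rewrite T10 -Hk.
have HM : (11 * e * #|H : 'N_H(<[x]>)| = 7920)%N -> H :=: M11.
  by rewrite Hk => H7; apply/eqP; rewrite eqEcard sHM H7 card_M11.
move: k1 cyc1 dvH HM {T10 Hk}; move: #|_ : _| => k k1 cyc1 dvH HM.
have {}e5 : e %| 5 by rewrite -(dvdn_pmul2l (isT : 0 < 11)%N).
have /primeP[_ /(_ _ e5)/pred2P[] eE] := isT : prime 5; rewrite eE in cyc1 dvH HM *.
  by rewrite cyc1 // (_ : 11 * 1 * 1 = 11)%N //; constructor 2.
have /dvdnP[d dk] : 5 * k %| 720.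
  by rewrite -(dvdn_pmul2r (isT : 0 < 11)%N) mulnC mulnA.
have {}dk : (d * k = 144)%N by lia.
have : k \in [seq j <- divisors 144 | j %% 11 == 1]%N.
  by rewrite mem_filter k1 eqxx -dvdn_divisors // -dk dvdn_mull.
rewrite (_ : filter _ _ = [:: 1; 12; 144]%N) // !inE => /or3P[]/eqP kE.
- by rewrite kE; constructor 2.
- by rewrite kE; constructor 3.
by constructor 1; apply: HM; rewrite kE.
Qed.

Lemma card_M11_order11 : #|M11 :&: of_order 11| = 1440.
Proof.
have [_ n144] := card_norm11_M11 M11c order_c.
by have [-> _] := card_order11 (subxx _) M11c order_c; rewrite n144.
Qed.

Lemma L2_11_sub : L2_11 \subset M11. Proof. by apply/subsetP => x; rewrite inE => /andP[]. Qed.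

(** A proper subgroup that contains both an element of order 11 and an
    involution. *)
Lemma card_L2_11 : #|L2_11| = 660 /\ #|L2_11 :&: of_order 11| = 120.
Proof.
have [LM|[L55 _]|//] := M11_subgroup_order11 (H := L2_11_group) L2_11_sub L2_11c order_c.
  by have := L2_11g; rewrite [L2_11]LM M11g.
have g2 : #[g ^+ 2] %| #|L2_11| by apply: (order_dvdG (G := L2_11_group)) L2_11g2.
have og2 : #[g ^+ 2] = 2.
  apply: nt_prime_order => //; last first.
    by apply/eqP => /(congr1 code); rewrite code1 code_powE code_g.
  by rewrite -expgM; apply: code_inj; rewrite code1 code_powE code_g.
by move: g2 L55; rewrite og2 !inE => + /orP[]/eqP E; rewrite E.
Qed.

Lemma M11_transT i : orbit 'P M11 i = setT.
Proof. by rewrite -M11_trans; apply/orbit_eqP; rewrite M11_trans inE. Qed.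

(** A non trivial normal subgroup has an element of order 11, hence by conjugacy
    all 1440 of them, which is too many for a proper subgroup. *)
Lemma M11_simple : simple M11.
Proof.
apply/simpleP; split; first by rewrite trivg_card1 card_M11.
move=> T nTM; have [sTM nT] := andP nTM.
have [|/Cauchy[//|x Tx x11]] := normal_prime_degree (isT : prime 11) M11_transT nTM; first by left.
right; have [//|[_ T10]|[_ T120]] := M11_subgroup_order11 sTM Tx x11.
  all: have := card_M11_order11; rewrite (_ : M11 :&: _ = T :&: of_order 11) ?T10 ?T120 //.
  all: apply/setP => y; rewrite !inE; case: eqP => y11; rewrite ?andbF // !andbT.
  all: apply/idP/idP => [My|]; last exact: (subsetP sTM).
  all: have [z Mz E] := Sylow_trans (Sylow_order11 (subxx _) (subsetP sTM x Tx) x11)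
                                   (Sylow_order11 (subxx _) My y11).
  all: by rewrite -cycle_subG E -(normsP nT z Mz) conjSg cycle_subG.
Qed.

Lemma M11_nonabelian : ~~ abelian M11.
Proof.
apply/negP => /centsP/(_ _ M11c _ M11g)/(congr1 code).
by rewrite [code (c * g)]codeM [code (g * c)]codeM code_c code_g.
Qed.

(** * Elements of order 8 *)

Definition root_g :=
  word [:: false; false; false; true; false; false; true; true; true; false; true].

Lemma root_gE : root_g ^+ 2 = g.
Proof. by apply: code_inj; rewrite code_powE code_word code_g. Qed.

Lemma order_root_g : #[root_g] = 8.
Proof.
have : #[root_g] \in divisors 8.
  rewrite -dvdn_divisors // order_dvdn (expgM _ 2 4) root_gE.
  by apply/eqP/code_inj; rewrite code_powE code_g code1.
have : ~~ (#[root_g] %| 4).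
  rewrite order_dvdn (expgM _ 2 2) root_gE; apply/eqP => /(congr1 code).
  by rewrite code_powE code_g code1.
rewrite (_ : divisors 8 = [:: 1; 2; 4; 8]%N) // !inE => n4.
by case/or4P=> /eqP E; rewrite E in n4 *.
Qed.

(** An element that centralizes g permutes the 8 points that g moves, and it is
    determined by the image of 2, hence of the cycle of 2 under g. *)
Lemma cent_g : #|'C_M11[g]| <= 8.
Proof.
have gE (k : 'I_11) : g k = nth 0%N g_code k :> nat by rewrite -code_g nth_code.
have supp : #|[set i | g i != i]| = 8.
  rewrite cardsE cardE /enum_mem size_filter -enumT.
  rewrite (@eq_count _ _ (preim val (fun i => nth 0%N g_code i != i))) => [|i].
    by rewrite -count_map val_enum_ord.
  by rewrite -[LHS]/(g i != i) -(inj_eq val_inj) /= gE.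
have inj : {in 'C_M11[g] &, injective (fun z : 'S_11 => z p)}.
  move=> z t /setIP[Mz /cent1P zg] /setIP[Mt /cent1P tg] /= zt.
  apply/eqP; rewrite eq_mulgV1; apply/eqP/M11_four_points.
    by rewrite groupM ?groupV.
  have fp : (z * t^-1) p = p by rewrite permM zt permK.
  have stepf (i : 'I_11) : (z * t^-1) i = i -> (z * t^-1) (g i) = g i.
    move=> fi; rewrite -permM.
    have -> : g * (z * t^-1) = (z * t^-1) * g.
      by apply: commuteM; [exact: commute_sym | apply: commuteV; exact: commute_sym].
    by rewrite permM fi.
  have g2 : g p = inord 6 by apply: val_inj; rewrite /= gE !inordK.
  have g6 : g (inord 6) = inord 10 by apply: val_inj; rewrite /= gE !inordK.
  have g10 : g (inord 10) = inord 7 by apply: val_inj; rewrite /= gE !inordK.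
  have f6 := stepf _ fp; rewrite g2 in f6; have f10 := stepf _ f6; rewrite g6 in f10.
  have f7 := stepf _ f10; rewrite g10 in f7.
  by move=> k; rewrite !inE => /or4P[]/eqP->.
rewrite -(card_in_imset inj) -[8 in leqRHS]supp.
apply/subset_leq_card/subsetP => _ /imsetP[z /setIP[_ /cent1P zg] ->].
rewrite inE /= -permM zg permM (inj_eq perm_inj) -val_eqE /= gE inordK //.
Qed.

Lemma Sylow2_le (H P : {group 'S_11}) : H \subset M11 -> 2.-Sylow(H) P -> #|P| %| 16.
Proof.
move=> sHM sylP; rewrite (card_Hall sylP).
have <- : (#|M11|`_2)%N = 16 by rewrite card_M11_dvd p_part (_ : logn 2 _ = 4).
by rewrite partn_dvd ?cardG_gt0 // cardSg.
Qed.

Lemma order8_2group (z : 'S_11) : #[z] = 8 -> 2.-group <[z]>.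
Proof. by rewrite /pgroup -orderE => ->. Qed.

(** A Sylow 2-subgroup has order 16 and by [cent_g] a single cyclic subgroup of
    order 8, so all cyclic subgroups of order 8 in M11 are conjugate to
    [<[root_g]>]. *)
Lemma cent_sqr_order8 z : z \in M11 -> #[z] = 8 -> #|'C_M11[z ^+ 2]| <= 8.
Proof.
move=> Mz z8; have Mr : root_g \in M11 := M11_word _.
have sr : <[root_g]> \subset M11 by rewrite cycle_subG.
have sz : <[z]> \subset M11 by rewrite cycle_subG.
have [P sylP rP] := Sylow_superset sr (order8_2group order_root_g).
have sPM := pHall_sub sylP; rewrite cycle_subG in rP.
have [y My] := Sylow_subJ sylP sz (order8_2group z8).
rewrite cycle_subG mem_conjg => zP.
have E : <[z ^ y^-1]> = <[root_g]>.
  apply: (cycle8_unique _ rP zP order_root_g); rewrite ?orderJ ?root_gE //.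
    exact: dvdn_leq (Sylow2_le (subxx _) sylP).
  by rewrite (leq_trans _ cent_g) // subset_leq_card ?setSI.
have Ez : <[z]> = <[root_g]> :^ y by rewrite -E cycleJ conjsgKV.
have -> : 'C_M11[z ^+ 2] = 'C_M11[g] :^ y; last by rewrite cardJg cent_g.
have Ez2 : <[z ^+ 2]> = <[g]> :^ y.
  have srz : <[g]> :^ y \subset <[z]> by rewrite Ez conjSg cycle_subG -root_gE mem_cycle.
  apply/eqP; rewrite (eq_subG_cyclic (cycle_cyclic z)) ?cycle_subG ?mem_cycle //.
  by rewrite cardJg -!orderE -root_gE !orderXdiv ?z8 ?order_root_g.
by rewrite -!cent_cycle Ez2 centJ conjIg conjGid.
Qed.

(** The same argument inside H: each Sylow 2-subgroup of H that contains an
    element of order 8 normalizes the cyclic subgroup that it generates. *)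
Lemma card_order8 (H : {group 'S_11}) z : H \subset M11 -> z \in H -> #[z] = 8 ->
  #|H :&: of_order 8| = (4 * #|H : 'N_H(<[z]>)|)%N /\ (#|H|`_2 %| #|'N_H(<[z]>)|)%N.
Proof.
move=> sHM Hz z8; have Cz := cent_sqr_order8 (subsetP sHM z Hz) z8.
have sz : <[z]> \subset H by rewrite cycle_subG.
have [P sylP zP] := Sylow_superset sz (order8_2group z8).
have sPH := pHall_sub sylP; rewrite cycle_subG in zP.
have uniq8 t : t \in P -> #[t] = 8 -> <[t]> = <[z]>.
  move=> Pt t8; apply: (cycle8_unique _ zP Pt z8 t8).
    exact: dvdn_leq (Sylow2_le sHM sylP).
  by rewrite (leq_trans _ Cz) // subset_leq_card ?setSI ?(subset_trans sPH).
split.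
  have := card_of_order Hz; rewrite z8 => -> // t /setIP[Ht]; rewrite inE => /eqP t8.
  have st : <[t]> \subset H by rewrite cycle_subG.
  have [y Hy] := Sylow_subJ sylP st (order8_2group t8).
  rewrite cycle_subG mem_conjg => tP; exists y => //.
  by rewrite -(uniq8 _ tP) ?orderJ // cycleJ conjsgKV.
rewrite -(card_Hall sylP); apply: cardSg; rewrite subsetI sPH.
apply/subsetP => y Py; apply/normP; rewrite -cycleJ.
by rewrite uniq8 ?groupJ ?orderJ.
Qed.

(** The normalizer contains a Sylow 2-subgroup by [card_order8], and its order is
    at most 4 * 8 by [norm_cycle_le]. *)
Lemma card_norm8_M11 z : z \in M11 -> #[z] = 8 -> #|'N_M11(<[z]>)| = 16.
Proof.
move=> Mz z8; have Cz := cent_sqr_order8 Mz z8.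
have [_] := card_order8 (subxx _) Mz z8.
have -> : (#|M11|`_2)%N = 16 by rewrite card_M11_dvd p_part (_ : logn 2 _ = 4).
have le32 : #|'N_M11(<[z]>)| <= 32.
  apply: leq_trans (norm_cycle_le _ _) _.
  rewrite z8 (_ : totient 8 = 4) // (leq_pmul2l (n2 := 8) (isT : 0 < 4)%N).
  apply: leq_trans Cz; apply/subset_leq_card/setIS.
  by rewrite -!cent_cycle centS // cycle_subG mem_cycle.
have : #|'N_M11(<[z]>)| %| 720 * 11 by rewrite -card_M11_dvd cardSg ?subsetIl.
move=> dv /dvdnP[k Ek]; move: dv le32; rewrite Ek.
have : (0 < k * 16)%N by rewrite -Ek cardG_gt0.
by case: k {Ek} => [|[|[|k]]] // _; lia.
Qed.

Lemma card_M11_order8 : #|M11 :&: of_order 8| = 1980.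
Proof.
have Mr : root_g \in M11 := M11_word _.
have [-> _] := card_order8 (subxx _) Mr order_root_g.
have := Lagrange (subsetIl M11 'N(<[root_g]>)).
rewrite card_M11_dvd (card_norm8_M11 Mr order_root_g) (_ : 720 * 11 = 16 * 495)%N //.
by move/eqP; rewrite eqn_pmul2l // => /eqP->.
Qed.

(** The number of conjugates of a cyclic subgroup of order 8 divides the odd part
    45 of 720. *)
Lemma card_order8_le (H : {group 'S_11}) : H \subset M11 -> #|H| %| 720 ->
  #|H :&: of_order 8| <= 180.
Proof.
move=> sHM H720.
have [->|[z]] := set_0Vmem (H :&: of_order 8); first by rewrite cards0.
rewrite !inE => /andP[Hz /eqP z8]; have [-> N2] := card_order8 sHM Hz z8.
rewrite (_ : 180 = 4 * 45)%N // leq_pmul2l //.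
apply: dvdn_leq => //.
have dv2 : #|H : 'N_H(<[z]>)| %| (#|H|`_2^')%N.
  rewrite -(dvdn_pmul2l (cardG_gt0 'N_H(<[z]>)%G)) Lagrange ?subsetIl //.
  by rewrite -{1}(partnC 2 (cardG_gt0 H)) dvdn_pmul2r.
apply: dvdn_trans dv2 _; have -> : 45 = (720`_2^')%N.
  apply/eqP; rewrite -(eqn_pmul2l (isT : 0 < 16)%N).
  by have := partnC 2 (isT : 0 < 720)%N; rewrite p_part (_ : logn 2 _ = 4) // => ->.
by rewrite partn_dvd.
Qed.

(** The order 720 is a multiple of 16, so that the stabilizer contains a Sylow
    2-subgroup of M11. *)
Lemma card_stab_order8 : #|'C_M11[p | 'P] :&: of_order 8| = 180.
Proof.
set S := 'C_M11[p | 'P]; have sSM : S \subset M11 := subsetIl _ _.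
have Mr : root_g \in M11 := M11_word _.
have sr : <[root_g]> \subset M11 by rewrite cycle_subG.
have part2 : (#|M11|`_2 = #|S|`_2)%N.
  rewrite card_M11_stab card_M11_dvd !p_part.
  by rewrite (_ : logn 2 (720 * 11) = 4) // (_ : logn 2 720 = 4).
have [P sylP] := Sylow_exists 2 [group of S].
have sylM : 2.-Sylow(M11) P.
  rewrite pHallE (subset_trans (pHall_sub sylP)) //= (card_Hall sylP) eq_sym.
  exact/eqP.
have [y My] := Sylow_subJ sylM sr (order8_2group order_root_g).
rewrite cycle_subG mem_conjg => /(subsetP (pHall_sub sylP)).
move: (root_g ^ y^-1) (orderJ root_g y^-1) => z /[!order_root_g] z8 Sz.
have [-> N2] := card_order8 (H := [group of S]) sSM Sz z8.
have N16 : #|'N_S(<[z]>)| %| 16.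
  by rewrite -(card_norm8_M11 (subsetP sSM _ Sz) z8) cardSg // setSI.
have S2 : (#|S|`_2 = 16)%N by rewrite card_M11_stab p_part (_ : logn 2 _ = 4).
have {N2} NE : #|'N_S(<[z]>)| = 16.
  by apply/eqP; rewrite eqn_dvd N16 -S2.
have := Lagrange (subsetIl [group of S] 'N(<[z]>)); rewrite /= NE card_M11_stab.
rewrite (_ : 720 = 16 * 45)%N //.
by move/eqP; rewrite eqn_pmul2l // => /eqP->.
Qed.

(** * The covering number of the wreath product of M11 *)

Local Notation T11 := (subg_of M11).

Lemma sgval_of_order (M : {group T11}) k :
  sgval @* (M :&: of_order k) = sgval @* M :&: of_order k.
Proof.
have ordv (x : T11) : #[sgval x] = #[x] by rewrite (order_injm (injm_sgval _)) ?inE.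
apply/setP => y; apply/morphimP/setIP => [[x _ /setIP[Mx xk] ->]|[/morphimP[x _ Mx ->] xk]].
  by rewrite mem_morphim ?inE // ordv; rewrite inE in xk.
by exists x; rewrite ?inE // Mx; rewrite inE ordv in xk.
Qed.

Lemma card_sgval (M : {set T11}) : #|sgval @* M| = #|M|.
Proof. by rewrite card_injm ?injm_sgval ?subsetT. Qed.

Lemma card_sgval_of_order (M : {group T11}) k : #|M :&: of_order k| = #|sgval @* M :&: of_order k|.
Proof. by rewrite -sgval_of_order card_sgval. Qed.

(** The stabilizers in the actions of M11 of degrees 11 and 12, and the orders of
    the elements that detect them: elements of order 11 have no fixed point in
    degree 11, and elements of order 8 have none in degree 12. *)
Definition M11_rep (b : bool) : {group T11} :=
  (subg M11 @* (if b then [group of 'C_M11[p | 'P]] else [group of L2_11]))%G.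
Definition M11_test (b : bool) : {set T11} := of_order (if b then 8 else 11).

Lemma sgval_M11_rep b : sgval @* M11_rep b = if b then 'C_M11[p | 'P] else L2_11.
Proof.
by rewrite /=; case: b; rewrite subgmK //=; [exact: subsetIl | exact: L2_11_sub].
Qed.

Lemma card_M11_rep b : #|M11_rep b| = if b then 720 else 660.
Proof.
rewrite -card_sgval sgval_M11_rep; case: b; first exact: card_M11_stab.
by have [] := card_L2_11.
Qed.

Lemma card_M11_rep_test b : #|M11_rep b :&: M11_test b| = if b then 180 else 120.
Proof.
rewrite card_sgval_of_order sgval_M11_rep; case: b; first exact: card_stab_order8.
by have [] := card_L2_11.
Qed.

Lemma card_T11 : #|T11| = (720 * 11)%N.
Proof. by rewrite -cardsT -card_M11_dvd; apply/esym/card_isog/isog_subg. Qed.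

Lemma index_M11_rep b : #|[set: T11] : M11_rep b| = if b then 11 else 12.
Proof.
have := Lagrange (subsetT (M11_rep b)); rewrite cardsT card_T11 card_M11_rep.
case: b; last rewrite (_ : 720 * 11 = 660 * 12)%N //;
  by move/eqP; rewrite eqn_pmul2l // => /eqP.
Qed.

Lemma card_M11_test b : #|M11_test b| = if b then 1980 else 1440.
Proof.
rewrite -[M11_test b]setTI card_sgval_of_order im_sgval; case: b.
  exact: card_M11_order8.
exact: card_M11_order11.
Qed.

Lemma M11_test_norm b x : M11_test b :^ x = M11_test b.
Proof. by apply/setP => y; rewrite mem_conjg !inE orderJ. Qed.

(** Subgroups with no element of order 11 have order dividing 720, and the others
    were determined above: none has elements of both orders. *)
Lemma M11_test_cap (M : {group T11}) : M \proper [set: T11] ->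
  exists b, [/\ M :&: M11_test (~~ b) = set0, #|M| <= #|M11_rep b| &
                #|M :&: M11_test b| <= #|M11_rep b :&: M11_test b|].
Proof.
move=> ltM; pose H := [group of sgval @* M].
have sHM : H \subset M11 := sgval_sub _.
have HM : #|H| = #|M| := card_sgval M.
have ltH : H :!=: M11.
  apply: contraTneq ltM => HE; rewrite properE subsetT negbK.
  apply/subsetP => x _; have : sgval x \in H by rewrite HE subgP.
  by case/morphimP=> y _ My /subg_inj->.
have [Meq0|[x]] := set_0Vmem (M :&: of_order 11).
  exists true; rewrite card_M11_rep card_M11_rep_test.
  have H720 : #|H| %| 720.
    have := cardSg sHM; rewrite card_M11_dvd Gauss_dvdl // coprime_sym prime_coprime //.
    apply/negP => /Cauchy[//|y Hy y11].
    have := cards0 T11; rewrite -Meq0 card_sgval_of_order => /eqP; rewrite cards_eq0.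
    by move/eqP/setP/(_ y); rewrite !inE y11 Hy.
  split=> //; first by rewrite -HM dvdn_leq.
  by rewrite card_sgval_of_order card_order8_le.
move=> Mx; have : 0 < #|M :&: of_order 11| by apply/card_gt0P; exists x.
rewrite card_sgval_of_order => /card_gt0P[y]; rewrite !inE => /andP[Hy /eqP y11].
have no8 : ~~ (8 %| #|H|) -> M :&: M11_test true = set0.
  move=> n8; apply/setP => z; rewrite !inE; apply/negP => /andP[Mz /eqP z8].
  by case/negP: n8; have := order_dvdG Mz; rewrite z8 HM.
exists false; rewrite card_M11_rep card_M11_rep_test -HM (card_sgval_of_order M 11).
have [HE|[H55 ->]|[H660 ->]] := M11_subgroup_order11 sHM Hy y11.
- by rewrite HE eqxx in ltH.
- by split=> //; [apply: no8; move: H55 | move: H55]; rewrite !inE => /orP[]/eqP->.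
by split=> //; [apply: no8|]; rewrite H660.
Qed.

Lemma M11_rep_cover x : exists b y, x \in M11_rep b :^ y.
Proof.
have memA b z : (z \in M11_rep b) = (sgval z \in if b then 'C_M11[p | 'P] else L2_11).
  rewrite -sgval_M11_rep; apply/idP/morphimP => [Az|[t _ At /subg_inj->] //].
  by exists z; rewrite ?inE.
have lift y : y \in M11 -> {Y : T11 | sgval Y = y} by move=> My; exists (subg M11 y); rewrite subgK.
have [[y My xy]|[y My xy]] := M11_cover (subgP x); have [Y yE] := lift y My.
  by exists true, Y; rewrite mem_conjg memA -[sgval _]/(sgval x ^ (sgval Y)^-1) yE -mem_conjg.
by exists false, Y; rewrite mem_conjg memA -[sgval _]/(sgval x ^ (sgval Y)^-1) yE -mem_conjg.
Qed.

Close Scope group_scope.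
Unset Implicit Arguments.

Theorem corollary1p2 (m : nat) (m_gt0 : 0 < m) :
  sigma [set: M11_wr_C m]%G = size (primes m) + 11 ^ m + 12 ^ m.
Proof.
case: m m_gt0 => // n _.
rewrite (@sigma_wreath_cyclic _ n M11_rep M11_test) ?index_M11_rep //.
- by rewrite -(isog_simple (isog_subg M11)) M11_simple.
- by rewrite -(isog_abelian (isog_subg M11)) M11_nonabelian.
- exact: M11_test_norm.
- exact: M11_test_cap.
- by move=> b; rewrite card_M11_test index_M11_rep card_M11_rep_test; case: b.
- move=> b; rewrite card_T11 card_M11_rep card_M11_rep_test; case: b; lia.
- rewrite card_T11 !card_M11_test; lia.
- move=> b; rewrite properE subsetT; apply/negP => /subset_leq_card.
  by rewrite cardsT card_T11 card_M11_rep; case: b; lia.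
exact: M11_rep_cover.
Qed.
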